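(* Let $R=R_1\times R_2\times\cdots\times R_s$ with $s\ge 2$, where each $R_i$ is a finite local ring with maximal ideal $M_i$ of order $m_i$, and where $|R_1|/m_1\le |R_2|/m_2\le\cdots\le |R_s|/m_s$. Then the unitary Cayley graph $G_R$ is Ramanujan if and only if $R$ satisfies one of the following conditions: (a) $R_i/M_i\cong\mathbb{F}_2$ for $i=1,\ldots,s$; (b) $R_i\cong\mathbb{F}_2$ for $i=1,\ldots,s-3$, and $R_i\cong\mathbb{F}_3$ for $i=s-2,s-1,s$; (c) $R_i\cong\mathbb{F}_2$ for $i=1,\ldots,s-3$, $R_i\cong\mathbb{F}_3$ for $i=s-2,s-1$, and $R_s\cong\mathbb{F}_4$; (d) $R_i\cong\mathbb{F}_2$ for $i=1,\ldots,s-3$, and $R_i\cong\mathbb{F}_4$ for $i=s-2,s-1,s$; (e) $R_i\cong\mathbb{F}_2$ for $i=1,\ldots,s-2$, $R_{s-1}\cong\mathbb{F}_3$, and $R_s\cong\mathbb{Z}_9$ or $R_s\cong\mathbb{Z}_3[X]/(X^3)$; (f) $R_1\cong\mathbb{Z}_4$ or $R_1\cong\mathbb{Z}_2[X]/(X^2)$, $R_i\cong\mathbb{F}_2$ for $i=2,\ldots,s-2$, and $R_{s-1}\cong\mathbb{F}_{q_1}$, $R_s\cong\mathbb{F}_{q_2}$ for some prime powers $q_1,q_2\ge 3$ with $q_1\le q_2\le q_1+\sqrt{(q_1-2)q_1}$; (g) $R_i\cong\mathbb{F}_2$ for $i=1,\ldots,s-2$, and $R_{s-1}\cong\mathbb{F}_{q_1}$,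 $R_s\cong\mathbb{F}_{q_2}$ for some prime powers $q_1,q_2\ge 3$ with $q_1\le q_2\le 2\left(q_1+\sqrt{(q_1-2)q_1}\right)-1$; (h) $R_i/M_i\cong\mathbb{F}_2$ for $i=1,\ldots,s-1$, $R_s/M_s\cong\mathbb{F}_q$ for some prime power $q\ge 3$, and $\prod_{i=1}^s m_i\le 2\left(q-1+\sqrt{(q-2)q}\right)$.
   Context: Rings are commutative with identity $1\neq 0$. For a finite commutative ring $R$, $R^\times$ denotes its group of units. The unitary Cayley graph $G_R$ is the graph with vertex set $R$ in which $x,y\in R$ are adjacent if and only if $x-y\in R^\times$; it is $|R^\times|$-regular. A local ring is a commutative ring with a unique maximal ideal. $\mathbb{F}_q$ denotes the finite field with $q$ elements and $\mathbb{Z}_n=\mathbb{Z}/n\mathbb{Z}$; isomorphisms are ring isomorphisms. The eigenvalues of a graph are those of its adjacency matrix. A finite $r$-regular graph is Ramanujan if every eigenvalue $\lambda$ with $\lambda\neq\pm r$ satisfies $|\lambda|\le 2\sqrt{r-1}$.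
   Formalization: In (e), Z_3[X]/(X^3) is corrected to Z_3[X]/(X^2) (with X^3 the claim is false), and the conditions are required only after some renumbering of the factors that keeps |R_i|/m_i nondecreasing, since (e) and (f) fix positions among ties (e.g. F_2×Z_4×F_3×F_3). *)

(* Defs.v *)
From HB Require Import structures.
From mathcomp Require Import all_boot all_order all_algebra all_fingroup all_field.
From mathcomp Require Import ring_quotient qpoly.

Set Implicit Arguments.
Unset Strict Implicit.
Unset Printing Implicit Defensive.

Import Order.TTheory GRing.Theory Num.Theory.
Local Open Scope ring_scope.

(* The bound 1 < s is an argument of the type because the product is a nonzero
   ring only when it has at least one factor. *)
Definition ring_prod (s : nat) (hs : (1 < s)%N)
  (R : 'I_s -> finComNzRingType) := {dffun forall i : 'I_s, R i}.

Section RingProd.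
Variables (s : nat) (hs : (1 < s)%N) (R : 'I_s -> finComNzRingType).
Local Notation P := (ring_prod hs R).

HB.instance Definition _ := Finite.on P.

Implicit Types x y z : P.

Definition prod_zero : P := [ffun i : 'I_s => (0 : R i)].
Definition prod_one : P := [ffun i : 'I_s => (1 : R i)].
Definition prod_opp x : P := [ffun i : 'I_s => (- x i : R i)].
Definition prod_add x y : P := [ffun i : 'I_s => (x i + y i : R i)].
Definition prod_mul x y : P := [ffun i : 'I_s => (x i * y i : R i)].

Fact prod_addA : associative prod_add.
Proof. by move=> x y z; apply/ffunP=> i; rewrite !ffunE addrA. Qed.
Fact prod_addC : commutative prod_add.
Proof. by move=> x y; apply/ffunP=> i; rewrite !ffunE addrC. Qed.
Fact prod_add0 : left_id prod_zero prod_add.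
Proof. by move=> x; apply/ffunP=> i; rewrite !ffunE add0r. Qed.
Fact prod_addN : left_inverse prod_zero prod_opp prod_add.
Proof. by move=> x; apply/ffunP=> i; rewrite !ffunE addNr. Qed.

HB.instance Definition _ :=
  GRing.isZmodule.Build P prod_addA prod_addC prod_add0 prod_addN.

Fact prod_mulA : associative prod_mul.
Proof. by move=> x y z; apply/ffunP=> i; rewrite !ffunE mulrA. Qed.
Fact prod_mulC : commutative prod_mul.
Proof. by move=> x y; apply/ffunP=> i; rewrite !ffunE mulrC. Qed.
Fact prod_mul1 : left_id prod_one prod_mul.
Proof. by move=> x; apply/ffunP=> i; rewrite !ffunE mul1r. Qed.
Fact prod_mulDl : left_distributive prod_mul prod_add.
Proof. by move=> x y z; apply/ffunP=> i; rewrite !ffunE mulrDl. Qed.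
Fact prod_one_neq0 : prod_one != prod_zero.
Proof.
apply/eqP=> /ffunP /(_ (Ordinal (ltnW hs))).
by rewrite !ffunE => /eqP; rewrite oner_eq0.
Qed.

HB.instance Definition _ := GRing.Zmodule_isComNzRing.Build P
  prod_mulA prod_mulC prod_mul1 prod_mulDl prod_one_neq0.

(* The library's generic unit structure on a finite ring. *)
HB.instance Definition _ := FinRing.isNzRing.Build P.

End RingProd.

Definition unitary_cayley (R : finComUnitRingType) : rel R :=
  fun x y => x - y \is a GRing.unit.

Definition adjacency (V : finType) (e : rel V) : 'M[algC]_#|V| :=
  \matrix_(i, j) (e (enum_val i) (enum_val j))%:R.

Definition regular (V : finType) (e : rel V) (r : nat) : Prop :=
  forall x : V, #|[set y | e x y]| = r.

Definition ramanujan (V : finType) (e : rel V) : Prop :=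
  exists r : nat, regular e r /\
    forall l : algC, eigenvalue (adjacency e) l ->
      l != r%:R -> l != - r%:R -> `|l| <= 2 * sqrtC (r%:R - 1).

(* The type [idealr R] consists of the proper ideals of R. *)
Definition maximal_ideal (R : comNzRingType) (M : idealr R) : Prop :=
  forall J : idealr R, {subset M <= J} -> {subset J <= M}.

Definition local_ring_with (R : comNzRingType) (M : idealr R) : Prop :=
  maximal_ideal M /\ forall N : idealr R, maximal_ideal N -> N =i M.

Definition ring_iso (A B : pzRingType) : Prop :=
  exists f : {rmorphism A -> B}, bijective f.

(* A is isomorphic to the field with q elements; naming it through an arbitrary
   field of cardinal q is harmless, as all of them are isomorphic. *)
Definition iso_Fq (A : pzRingType) (q : nat) : Prop :=
  exists F : finFieldType, #|F| = q /\ ring_iso A F.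

Definition prime_power (q : nat) : Prop :=
  exists p k : nat, [/\ prime p, (0 < k)%N & q = (p ^ k)%N].

Section Conditions.
Variables (s : nat) (R : 'I_s -> finComNzRingType).
Variable M : forall i, idealr (R i).

(* The divisions are exact, by Lagrange. *)
Definition residue_sorted : Prop :=
  forall i j : 'I_s, (i <= j)%N ->
    (#|R i| %/ #|M i| <= #|R j| %/ #|M j|)%N.

(* Below, the factor usually written R_k, with 1 <= k <= s, is [R i] for the
   ordinal [i] with [i.+1 = k].  The guards [2 < s] say that R_(s-2) exists;
   subtraction on [nat] is truncated.  [residue_sorted] leaves the order of
   factors with equal residue cardinal free, and [cond_e] and [cond_f] depend on
   that order; hence they must be read up to an admissible renumbering. *)

Definition cond_a : Prop :=
  forall i, iso_Fq {ideal_quot (M i)} 2.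

Definition cond_b : Prop :=
  (2 < s)%N /\
  forall i : 'I_s,
    [/\ (i.+1 <= s - 3)%N -> iso_Fq (R i) 2
      & (s - 2 <= i.+1 <= s)%N -> iso_Fq (R i) 3].

Definition cond_c : Prop :=
  (2 < s)%N /\
  forall i : 'I_s,
    [/\ (i.+1 <= s - 3)%N -> iso_Fq (R i) 2,
        (s - 2 <= i.+1 <= s - 1)%N -> iso_Fq (R i) 3
      & i.+1 = s -> iso_Fq (R i) 4].

Definition cond_d : Prop :=
  (2 < s)%N /\
  forall i : 'I_s,
    [/\ (i.+1 <= s - 3)%N -> iso_Fq (R i) 2
      & (s - 2 <= i.+1 <= s)%N -> iso_Fq (R i) 4].

(* The two local rings of order 9 that are not fields; the exponent is 2, since
   with Z_3[X]/(X^3) (order 27) the graph is not Ramanujan. *)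
Definition cond_e : Prop :=
  forall i : 'I_s,
    [/\ (i.+1 <= s - 2)%N -> iso_Fq (R i) 2,
        i.+1 = (s - 1)%N -> iso_Fq (R i) 3
      & i.+1 = s ->
          ring_iso (R i) 'Z_9 \/
          ring_iso (R i) {poly %/ ('X^2 : {poly 'Z_3})}].

Definition cond_f : Prop :=
  exists q1 q2 : nat,
    [/\ prime_power q1 /\ prime_power q2,
        (3 <= q1)%N /\ (3 <= q2)%N,
        (q1 <= q2)%N,
        (q2%:R : algC) <= q1%:R + sqrtC ((q1%:R - 2) * q1%:R)
      & forall i : 'I_s,
          [/\ i.+1 = 1%N ->
                ring_iso (R i) 'Z_4 \/
                ring_iso (R i) {poly %/ ('X^2 : {poly 'Z_2})},
              (2 <= i.+1 <= s - 2)%N -> iso_Fq (R i) 2,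
              i.+1 = (s - 1)%N -> iso_Fq (R i) q1
            & i.+1 = s -> iso_Fq (R i) q2]].

Definition cond_g : Prop :=
  exists q1 q2 : nat,
    [/\ prime_power q1 /\ prime_power q2,
        (3 <= q1)%N /\ (3 <= q2)%N,
        (q1 <= q2)%N,
        (q2%:R : algC) <=
          2 * (q1%:R + sqrtC ((q1%:R - 2) * q1%:R)) - 1
      & forall i : 'I_s,
          [/\ (i.+1 <= s - 2)%N -> iso_Fq (R i) 2,
              i.+1 = (s - 1)%N -> iso_Fq (R i) q1
            & i.+1 = s -> iso_Fq (R i) q2]].

Definition cond_h : Prop :=
  exists q : nat,
    [/\ prime_power q,
        (3 <= q)%N,
        ((\prod_(i < s) #|M i|)%N%:R : algC) <=
          2 * (q%:R - 1 + sqrtC ((q%:R - 2) * q%:R))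
      & forall i : 'I_s,
          [/\ (i.+1 <= s - 1)%N -> iso_Fq {ideal_quot (M i)} 2
            & i.+1 = s -> iso_Fq {ideal_quot (M i)} q]].

End Conditions.

(* Main.v *)
(** Write [q_i = |R_i| / m_i].  The adjacency matrix of [G_R] is the product over
    [i] of the commuting differences [S_i - T_i], where [S_i] and [T_i] are the
    Cayley matrices of the subgroups [R_i] and [M_i] of [R].  Since
    [S_i^2 = |R_i| S_i], [T_i^2 = m_i T_i] and [T_i S_i = m_i S_i], a common
    eigenvector shows that every eigenvalue is a product of numbers chosen among
    [m_i (q_i - 1)], [- m_i] and [0].  Let [r = prod_i m_i (q_i - 1)] be the degree.
    Unless all [q_i] are [2], the largest nontrivial eigenvalue in absolute value
    is [t = r / (q - 1)], where [q] is the smallest [q_i >= 3].  For integers, each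
    of [t <= 2 sqrt (r - 1)] and [t <= 2 (q - 1 + sqrt ((q - 2) q))] amounts to
    [t < 4 (q - 1)], so [G_R] is Ramanujan iff [r < 4 (q_j - 1)^2] for every
    [q_j >= 3].  This allows at most three [q_j >= 3], and forces [prod_i m_i <= 3]
    as soon as there are two of them.  Finally a local ring whose maximal ideal
    has prime order [p] satisfies [M^2 = 0], hence is [Z_(p^2)] or
    [F_p[X] / (X^2)] according to whether [p] vanishes in it. *)

From HB Require Import structures.
Require Import Defs.
From mathcomp Require Import all_boot all_order all_algebra all_fingroup all_field.
From mathcomp Require Import cyclic generic_quotient ring_quotient qpoly.
From mathcomp Require Import zify ring.

Set Implicit Arguments.
Unset Strict Implicit.
Unset Printing Implicit Defensive.

Import Order.TTheory GRing.Theory Num.Theory.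
Local Open Scope ring_scope.
Local Open Scope quotient_scope.

(** * Finite local rings *)

Section IdealSet.
Variable R : finComNzRingType.

(** Proper ideals as a boolean predicate on finite sets, so that [maxset_exists] can enlarge one to
    a maximal ideal. *)
Definition ideal_set (S : {set R}) : bool :=
  [&& 0 \in S, 1 \notin S &
      [forall a, forall u in S, forall v in S, a * u + v \in S]].

Lemma ideal_setP (S : {set R}) : reflect (idealr_closed (mem S)) (ideal_set S).
Proof.
apply: (iffP and3P) => -[S0 S1 HS]; split=> //.
  move=> a u v uS vS.
  by move/forallP: HS => /(_ a)/forall_inP/(_ u uS)/forall_inP/(_ v vS).
by apply/forallP=> a; apply/forall_inP=> u uS; apply/forall_inP=> v vS; apply: HS.
Qed.

Definition ideal_of_set (S : {set R}) (HS : ideal_set S) : idealr R :=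
  HB.pack (fun x => x \in S)
    (isIdealr.Build R (fun x => x \in S) (elimT (ideal_setP S) HS)).

Lemma mem_ideal_of_set S (HS : ideal_set S) : ideal_of_set HS =i S.
Proof. by []. Qed.

Lemma ideal_set_mem (M : idealr R) : ideal_set [set x | x \in M].
Proof.
apply/ideal_setP; split; rewrite ?inE ?rpred0 ?idealr1 // => a u v.
by rewrite !inE => uM vM; rewrite rpredD // idealMr.
Qed.

(** If the principal ideal [S] of [x] is proper, it lies in some maximal ideal, which is [M] by
    uniqueness; then [x] is in [M]. *)
Lemma local_unit (M : idealr R) : local_ring_with M ->
  forall x, x \notin M -> exists y, x * y = 1.
Proof.
move=> [_ uniqM] x xM.
pose S := [set x * y | y : R].
have [/imsetP[y _ ->]|S1] := boolP (1 \in S); first by exists y.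
have HS : ideal_set S.
  apply/ideal_setP; split=> //; first by apply/imsetP; exists 0; rewrite ?mulr0.
  move=> a _ _ /imsetP[u _ ->] /imsetP[v _ ->].
  by apply/imsetP; exists (a * u + v); rewrite // mulrDr mulrCA.
have [N /maxsetP[HN maxN] sSN] := maxset_exists HS.
have maxI : maximal_ideal (ideal_of_set HN).
  move=> J sNJ z zJ; rewrite mem_ideal_of_set.
  have <- : [set x | x \in J] = N.
    apply: maxN; first exact: ideal_set_mem.
    by apply/subsetP=> w wN; rewrite inE sNJ.
  by rewrite inE.
case/negP: xM; rewrite -(uniqM _ maxI) mem_ideal_of_set (subsetP sSN) //.
by apply/imsetP; exists 1; rewrite ?mulr1.
Qed.

Lemma ideal_mul_neq1 (M : idealr R) x y : x \in M -> x * y != 1.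
Proof.
by move=> xM; apply/eqP=> xy1; have := idealMr y xM; rewrite mulrC xy1 idealr1.
Qed.

End IdealSet.

Section ResidueRing.
Variables (R : finComNzRingType) (M : idealr R).

(** An alias of the quotient to which finiteness is attached, by means of the section [repr] into
    [R]. *)
Definition residue_ring : Type := {ideal_quot M}.
HB.instance Definition _ := GRing.ComNzRing.on residue_ring.
HB.instance Definition _ : isCountable residue_ring :=
  CanIsCountable (@reprK R {ideal_quot M}).
HB.instance Definition _ : isFinite residue_ring :=
  CanIsFinite (@reprK R {ideal_quot M}).

Lemma residue_ring_eq0 x : (\pi_{ideal_quot M} x == 0 :> residue_ring) = (x \in M).
Proof. by rewrite -[0](rmorph0 (\pi_{ideal_quot M})) -Quotient.idealrBE subr0. Qed.

(** Subtracting from each element the chosen representative of its class identifies [R] with the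
    product of [M] and the quotient. *)
Lemma card_ideal : #|R| = (#|M| * #|{: residue_ring}|)%N.
Proof.
pose f (x : R) : R * residue_ring :=
  (x - repr (\pi_{ideal_quot M} x), \pi_{ideal_quot M} x).
have f_inj : injective f by move=> x y [/[swap] ->] /addIr.
have -> : #|R| = #|codom f| by rewrite card_codom.
rewrite -cardX; apply: eq_card => -[a b]; rewrite inE /= andbT.
apply/codomP/idP => [[x [-> _]]|aM].
  by rewrite Quotient.idealrBE reprK.
exists (a + repr b); rewrite /f.
have -> : \pi_{ideal_quot M} (a + repr b) = b :> residue_ring.
  rewrite rmorphD /= reprK; suff /eqP-> : \pi_{ideal_quot M} a == 0 by rewrite add0r.
  by rewrite residue_ring_eq0.
by rewrite addrK.
Qed.

End ResidueRing.

Lemma ring_iso_sym (A B : pzRingType) : ring_iso A B -> ring_iso B A.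
Proof.
move=> [f [g fK gK]].
have gB : zmod_morphism g by move=> x y; apply: (can_inj fK); rewrite rmorphB !gK.
have gM : monoid_morphism g.
  by split=> [|x y]; apply: (can_inj fK); rewrite ?rmorph1 ?rmorphM !gK.
pose G : {rmorphism B -> A} := HB.pack g
  (GRing.isZmodMorphism.Build B A g gB) (GRing.isMonoidMorphism.Build B A g gM).
by exists G; exists f.
Qed.

Section FiniteField.
Variable A : finComNzRingType.

(** A copy of [A] that receives the generic unit structure of a finite ring, from which the field is
    then built. *)
Definition unital_copy : Type := A.
HB.instance Definition _ := FinRing.ComNzRing.on unital_copy.
HB.instance Definition _ := FinRing.isNzRing.Build unital_copy.

Lemma iso_Fq_of_inv :
  (forall x : A, x != 0 -> exists y, x * y = 1) -> iso_Fq A #|A|.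
Proof.
move=> invA.
have domA : GRing.integral_domain_axiom unital_copy.
  move=> x y xy0; have [//|/invA[z xz1]] := eqVneq x 0.
  by rewrite -[y]mul1r -xz1 mulrAC xy0 mul0r eqxx.
pose F := FinDomainFieldType domA.
exists F; split; first by [].
have fB : zmod_morphism (id : A -> F) by [].
have fM : monoid_morphism (id : A -> F) by [].
pose f : {rmorphism A -> F} := HB.pack (id : A -> F)
  (GRing.isZmodMorphism.Build A F _ fB) (GRing.isMonoidMorphism.Build A F _ fM).
by exists f; exists id.
Qed.

Lemma iso_Fq_card q : iso_Fq A q -> #|A| = q.
Proof. by move=> [F [<- [f /bij_eq_card]]]. Qed.

Lemma ring_iso_unit (F : fieldType) (x : A) : ring_iso A F ->
  x != 0 -> exists y, x * y = 1.
Proof.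
move=> [f bf] x0; have [g fK gK] := bf.
exists (g (f x)^-1); apply: (bij_inj bf); rewrite rmorphM rmorph1 gK divff //.
by rewrite -(rmorph0 f) (inj_eq (bij_inj bf)).
Qed.

(** The order of a finite field is a power of its characteristic; the exponent is positive because a
    field has more than one element. *)
Lemma prime_power_iso_Fq q : iso_Fq A q -> prime_power q.
Proof.
move=> [F [<- _]]; have [p p_pr pF] := finPcharP F.
have := card_pprimeChar pF; set n := logn _ _ => cF.
exists p, n; split=> //; rewrite lt0n; apply/eqP=> n0.
by have := finNzRing_gt1 F; rewrite cF n0.
Qed.

End FiniteField.

Lemma mulrn_card (V : finZmodType) (x : V) : x *+ #|V| = 0.
Proof. by have := @expg_cardG V [set: V]%G x (in_setT _); rewrite cardsT. Qed.

Section IdealField.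
Variables (R : finComNzRingType) (M : idealr R).

Lemma ideal_gt0 : (0 < #|M|)%N.
Proof. by apply/card_gt0P; exists 0; rewrite rpred0. Qed.

Lemma card_residueE : (#|R| %/ #|M|)%N = #|{: residue_ring M}|.
Proof. by rewrite (card_ideal M) mulKn // ideal_gt0. Qed.

Lemma card_residue_gt1 : (1 < #|R| %/ #|M|)%N.
Proof. by rewrite card_residueE; apply: finNzRing_gt1. Qed.

Lemma ideal_card1 x : #|M| = 1%N -> (x \in M) = (x == 0).
Proof.
move/mem_card1=> [y My].
by have := My 0; rewrite rpred0 My !inE => /esym/eqP->.
Qed.

(** A nonzero element of [M] would be invertible, against properness. *)
Lemma iso_Fq_ideal q : iso_Fq R q -> #|M| = 1%N /\ (#|R| %/ #|M|)%N = q.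
Proof.
move=> isoR; have M1 : #|M| = 1%N.
  rewrite -(card1 (0 : R)); apply: eq_card => x; rewrite [RHS]inE.
  apply/idP/eqP=> [xM|->]; last exact: rpred0.
  have [//|x0] := eqVneq x 0; case: isoR => F [_ isoF].
  have [y xy] := ring_iso_unit isoF x0.
  by have := ideal_mul_neq1 y xM; rewrite xy eqxx.
by rewrite M1 divn1 (iso_Fq_card isoR).
Qed.

Lemma iso_Fq_residue q : iso_Fq {ideal_quot M} q -> (#|R| %/ #|M|)%N = q.
Proof. by move=> isoq; rewrite card_residueE; apply: (@iso_Fq_card (residue_ring M)). Qed.

Hypothesis localM : local_ring_with M.

(** A representative of a nonzero class lies outside [M], hence is invertible already in [R]. *)
Lemma residue_iso : iso_Fq {ideal_quot M} (#|R| %/ #|M|).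
Proof.
rewrite card_residueE; apply: (@iso_Fq_of_inv (residue_ring M)) => x.
rewrite -[x]reprK residue_ring_eq0 => /(local_unit localM)[y xy].
exists (\pi_{ideal_quot M} y : residue_ring M).
by rewrite -[LHS](rmorphM (\pi_{ideal_quot M})) xy rmorph1.
Qed.

Lemma prime_power_residue : prime_power (#|R| %/ #|M|).
Proof. exact: (@prime_power_iso_Fq (residue_ring M)) residue_iso. Qed.

Lemma field_iso : #|M| = 1%N -> iso_Fq R (#|R| %/ #|M|).
Proof.
move=> M1; rewrite M1 divn1; apply: iso_Fq_of_inv => x.
by rewrite -(ideal_card1 x M1) => /(local_unit localM).
Qed.

Lemma card_dvd_additive (S T : {set R}) : zmod_closed (mem S) ->
  zmod_closed (mem T) -> S \subset T -> (#|S| %| #|T|)%N.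
Proof.
have grp (U : {set R}) : zmod_closed (mem U) -> group_set U.
  move=> [U0 UB]; apply/group_setP; split=> // x y xU yU.
  have : - y \in U by rewrite -sub0r UB.
  by move=> /(UB _ _ xU); rewrite opprK.
move=> /grp gS /grp gT; exact: (@cardSg _ (Group gT) (Group gS)).
Qed.

(** * Local rings whose maximal ideal has prime order *)

Section PrimeIdeal.
Variable p : nat.
Hypotheses (p_pr : prime p) (Mp : #|M| = p).

Let Mset := [set x | x \in M].
Let cardMset : #|Mset| = p.
Proof. by rewrite cardsE. Qed.
Let zmodM : zmod_closed (mem Mset).
Proof. by split=> [|x y]; rewrite !inE ?rpred0 // => *; rewrite rpredB. Qed.

(* [R x] is isomorphic to [R / Ann x], and both [R x] and [Ann x] are
   subgroups of the group [M] of prime order. *)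
Lemma prime_ideal_ann x : x \in M -> x != 0 ->
  (forall y, (y * x == 0) = (y \in M)) /\ #|R| = (p ^ 2)%N.
Proof.
move=> xM x0.
pose N := [set y | y * x == 0].
have HN : ideal_set N.
  apply/ideal_setP; split; rewrite ?inE ?mul0r ?mul1r // => a u v.
  by rewrite !inE => /eqP ux /eqP vx; rewrite mulrDl -mulrA ux vx mulr0 add0r.
(* An element outside [M] is invertible and cannot annihilate [x]. *)
have sNM : N \subset Mset.
  apply/subsetP=> y; rewrite !inE => /eqP yx; apply: contraLR x0.
  case/(local_unit localM) => z yz; rewrite negbK.
  by rewrite -[x]mul1r -yz mulrAC yx mul0r.
pose Rx := [set y * x | y : R].
have sRM : Rx \subset Mset.
  by apply/subsetP=> _ /imsetP[y _ ->]; rewrite inE idealMr.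
have zN : zmod_closed (mem N) := idealr_closedB (elimT (ideal_setP N) HN).
have zR : zmod_closed (mem Rx).
  split=> [|_ _ /imsetP[u _ ->] /imsetP[v _ ->]].
    by apply/imsetP; exists 0; rewrite ?mul0r.
  by apply/imsetP; exists (u - v); rewrite ?mulrBl.
have xR : x \in Rx by apply/imsetP; exists 1; rewrite ?mul1r.
have cRx : #|Rx| = p.
  have := card_dvd_additive zR zmodM sRM; rewrite cardMset.
  case/primeP: p_pr => _ dvdp /dvdp/orP[|/eqP//] /cards1P[y Ry].
  have R0 : 0 \in Rx := zR.1; move: R0 xR; rewrite Ry !inE => /eqP<- /eqP xx0.
  by rewrite xx0 eqxx in x0.
have cR : #|R| = (#|N| * p)%N.
  rewrite -cRx (card_ideal (ideal_of_set HN)); congr (_ * _)%N.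
  pose I := ideal_of_set HN.
  pose h (z : residue_ring I) := (repr z : R) * x.
  have hpi y : h (\pi_{ideal_quot I} y) = y * x.
    apply/eqP; rewrite -subr_eq0 -mulrBl.
    have : repr (\pi_{ideal_quot I} y) - y \in I by rewrite Quotient.idealrBE reprK.
    by rewrite mem_ideal_of_set inE.
  have h_inj : injective h.
    move=> z w; rewrite /h => /eqP; rewrite -subr_eq0 -mulrBl => zw.
    have : repr z - repr w \in I by rewrite mem_ideal_of_set inE.
    by rewrite Quotient.idealrBE !reprK => /eqP.
  rewrite -(card_codom h_inj); apply: eq_card => y.
  apply/codomP/imsetP => [[z ->]|[z _ ->]]; first by exists (repr z).
  by exists (\pi_{ideal_quot I} z); rewrite hpi.
have cN : #|N| = p.
  have := card_dvd_additive zN zmodM sNM; rewrite cardMset.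
  case/primeP: (p_pr) => _ dvdp /dvdp/orP[/eqP N1|/eqP//].
  (* A trivial annihilator would give [#|R| = p = #|M|], so the residue ring would have a single
     element. *)
  have := card_ideal M; rewrite cR N1 Mp mul1n -{1}[p]muln1 => /eqP.
  rewrite eqn_pmul2l ?prime_gt0 // => /eqP q1.
  by have := finNzRing_gt1 (residue_ring M); rewrite -q1.
split; last by rewrite cR cN -mulnn.
have /eqP NM : N == Mset by rewrite eqEcard sNM cN cardMset leqnn.
by move=> y; move/setP: NM => /(_ y); rewrite !inE.
Qed.

Lemma prime_ideal_neq0 : exists2 x, x \in M & x != 0.
Proof.
have [/existsP[x /andP[xM x0]]|] := boolP [exists x, (x \in M) && (x != 0)].
  by exists x.
rewrite negb_exists => /forallP H.
have : #|M| = 1%N.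
  rewrite -(card1 (0 : R)); apply: eq_card => x; rewrite [RHS]inE.
  have := H x; rewrite negb_and negbK => /orP[|/eqP->]; last by rewrite rpred0 eqxx.
  by move=> xM; rewrite (negPf xM); apply/esym; apply: contraNF xM => /eqP->; apply: rpred0.
by rewrite Mp => p1; move: p_pr; rewrite p1.
Qed.

Lemma prime_ideal_card : #|R| = (p ^ 2)%N.
Proof. by have [x xM /(prime_ideal_ann xM)[]] := prime_ideal_neq0. Qed.

Lemma prime_ideal_residue : (#|R| %/ #|M|)%N = p.
Proof. by rewrite prime_ideal_card Mp -mulnn mulnK ?prime_gt0. Qed.

Lemma prime_ideal_mul0 x y : x \in M -> y \in M -> x * y = 0.
Proof.
move=> xM yM; have [->|y0] := eqVneq y 0; first by rewrite mulr0.
by have [/(_ x)] := prime_ideal_ann yM y0; rewrite xM => /eqP.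
Qed.

(** The residue ring has order [p], hence is killed by [p]. *)
Lemma prime_ideal_natr : p%:R \in M.
Proof.
have cp : #|{: residue_ring M}| = p by rewrite -card_residueE prime_ideal_residue.
rewrite -residue_ring_eq0 rmorph_nat.
by rewrite -cp; apply/eqP; apply: mulrn_card.
Qed.

(** By Bezout, 1 is a combination of [n] and [p]; as [p] is in [M], having [n] in [M] would put 1
    there. *)
Lemma prime_ideal_natr_coprime n : (0 < n < p)%N -> n%:R \notin M.
Proof.
move=> /andP[n0 np]; apply/negP=> nM.
have : coprime n p.
  by rewrite coprime_sym prime_coprime // gtnNdvd.
case/coprimeP=> // -[u v] /= uv1.
have : (u * n - v * p)%N%:R \in M.
  rewrite natrB; last by rewrite ltnW // -subn_gt0 uv1.
  by rewrite !natrM rpredB // idealMr // prime_ideal_natr.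
by rewrite uv1 idealr1.
Qed.

(** The annihilator of [x] is [M], which contains no integer strictly between 0 and [p]. This gives
    the injectivity of the maps from the two model rings. *)
Lemma prime_ideal_natr_mul0 n x : x \in M -> x != 0 -> (n < p)%N ->
  n%:R * x = 0 -> n = 0%N.
Proof.
move=> xM x0 np /eqP; have [-> _] := prime_ideal_ann xM x0.
by move=> nM; apply/eqP; apply: contraLR nM; rewrite -lt0n => n0; apply: prime_ideal_natr_coprime; rewrite n0.
Qed.

End PrimeIdeal.
End IdealField.

(** * Morphisms from the model rings, and recognition of these rings *)

Section ZpMorphism.
Variables (R : finComNzRingType) (N : nat).
Hypotheses (N1 : (1 < N)%N) (N0 : N%:R = 0 :> R).

(** A ring morphism because [N] vanishes in [R]; [1 < N] ensures that the type ['Z_N] really has [N]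
    elements. *)
Definition natZp (x : 'Z_N) : R := (x : nat)%:R.

Lemma natr_modn n : (n %% N)%:R = n%:R :> R.
Proof. by rewrite {2}(divn_eq n N) natrD natrM N0 mulr0 add0r. Qed.

Lemma natZpB : zmod_morphism natZp.
Proof.
have natZpD : {morph natZp : x y / x + y}.
  move=> x y; rewrite /natZp /= -natrD -[RHS]natr_modn.
  by congr (_ %% _)%:R; apply: Zp_cast.
move=> x y; apply/(addIr (natZp y)); rewrite -natZpD !subrK //.
Qed.

Lemma natZpM : monoid_morphism natZp.
Proof.
split=> [|x y]; rewrite /natZp /=.
  by rewrite -[RHS]/(1%:R) -[RHS]natr_modn Zp_cast // modn_small.
by rewrite -natrM -[RHS]natr_modn; congr (_ %% _)%:R; apply: Zp_cast.
Qed.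

Definition natZp_morph : {rmorphism 'Z_N -> R} := HB.pack natZp
  (GRing.isZmodMorphism.Build _ _ natZp natZpB)
  (GRing.isMonoidMorphism.Build _ _ natZp natZpM).

End ZpMorphism.

Lemma rmorph_inj0 (A B : pzRingType) (f : {rmorphism A -> B}) :
  (forall x, f x = 0 -> x = 0) -> injective f.
Proof.
move=> f0 x y fxy; apply/eqP; rewrite -subr_eq0; apply/eqP/f0.
by rewrite rmorphB fxy subrr.
Qed.

Lemma size_dual p (f : {poly %/ ('X^2 : {poly 'Z_p})}) :
  (size (f : {poly 'Z_p}) <= 2)%N.
Proof.
rewrite -ltnS; apply: leq_trans (size_mk_monic f) _.
by rewrite mk_monic_Xn size_polyXn.
Qed.

Section DualNumbers.
Variables (R : finComNzRingType) (p : nat).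
Hypotheses (p1 : (1 < p)%N) (p0 : p%:R = 0 :> R).
Variables (x : R) (xx0 : x * x = 0).

(** The morphism sending the class of ['X] to the square-zero element [x], computed on reduced
    representatives. *)
Definition dual_eval (f : {poly %/ ('X^2 : {poly 'Z_p})}) : R :=
  (map_poly (natZp_morph p1 p0) (f : {poly 'Z_p})).[x].

Lemma dual_evalB : zmod_morphism dual_eval.
Proof. by move=> f g; rewrite -hornerN -hornerD -rmorphB. Qed.

(** A product in the quotient is a remainder modulo ['X^2]; the discarded multiple of ['X^2]
    evaluates to 0 since [x * x = 0]. *)
Lemma dual_evalM : monoid_morphism dual_eval.
Proof.
split=> [|f g]; rewrite /dual_eval.
  by rewrite -[polyn _]/(1 : {poly 'Z_p}) rmorph1 hornerC.
rewrite poly_of_qpolyM -hornerM -rmorphM; set h := _ * _.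
rewrite mk_monic_Xn [h in RHS](Pdiv.RingMonic.rdivp_eq (monicXn _ 2) h).
have X0 : (map_poly (natZp_morph p1 p0) 'X^2).[x] = 0.
  by rewrite map_polyXn hornerXn expr2.
by rewrite rmorphD rmorphM hornerD hornerM [X in _ * X + _]X0 mulr0 add0r.
Qed.

Definition dual_eval_morph : {rmorphism {poly %/ ('X^2 : {poly 'Z_p})} -> R} :=
  HB.pack dual_eval (GRing.isZmodMorphism.Build _ _ dual_eval dual_evalB)
  (GRing.isMonoidMorphism.Build _ _ dual_eval dual_evalM).

Lemma dual_evalE f : dual_eval f =
  natZp R (f : {poly 'Z_p})`_0 + natZp R (f : {poly 'Z_p})`_1 * x.
Proof.
rewrite /dual_eval (@horner_coef_wide _ 2); last first.
  exact: leq_trans (size_poly _ _) (size_dual _).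
by rewrite big_ord_recl big_ord1 !coef_map /= expr0 mulr1 expr1.
Qed.

End DualNumbers.

Lemma card_dual p : (1 < p)%N -> #|{: {poly %/ ('X^2 : {poly 'Z_p})}}| = (p ^ 2)%N.
Proof. by move=> p1; rewrite card_monic_qpoly ?size_polyXn ?monicXn //= card_ord Zp_cast. Qed.

(** Both models have [p ^ 2] elements, as [R] does, so an injective morphism from one of them to [R]
    suffices. *)
Lemma local_prime_ideal (R : finComNzRingType) (M : idealr R) p :
  local_ring_with M -> prime p -> #|M| = p ->
  ring_iso R 'Z_(p ^ 2) \/ ring_iso R {poly %/ ('X^2 : {poly 'Z_p})}.
Proof.
move=> locM p_pr Mp; have p1 := prime_gt1 p_pr.
have cR := prime_ideal_card locM p_pr Mp.
have pM := prime_ideal_natr locM p_pr Mp.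
have mul0 := prime_ideal_mul0 locM p_pr Mp.
have nat0 n x := @prime_ideal_natr_mul0 R M locM p p_pr Mp n x.
have cop n := @prime_ideal_natr_coprime R M locM p p_pr Mp n.
have [p0|p0] := eqVneq (p%:R : R) 0; [right|left]; apply: ring_iso_sym.
  have [x xM x0] := prime_ideal_neq0 p_pr Mp.
  pose f := dual_eval_morph p1 p0 (mul0 x x xM xM).
  exists f; apply: inj_card_bij; last by rewrite cR card_dual.
  apply: rmorph_inj0 => g; rewrite [f g]dual_evalE => g0.
  have lt (a : 'Z_p) : (a < p)%N by rewrite -{2}(Zp_cast p1) ltn_ord.
  (* The constant coefficient is the opposite of a multiple of [x], so it lies in [M]; being below
     [p], it is 0. *)
  have a0 : (g : {poly 'Z_p})`_0 = 0.
    apply/val_inj/eqP => /=; rewrite -leqn0 leqNgt; apply/negP=> a0.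
    have /negP[] : natZp R (g : {poly 'Z_p})`_0 \notin M by apply: cop; rewrite a0 lt.
    by move/eqP: g0; rewrite addr_eq0 => /eqP->; rewrite rpredN idealMr.
  have b0 : (g : {poly 'Z_p})`_1 = 0.
    apply/val_inj/(nat0 _ _ xM x0 (lt _)).
    by move: g0; rewrite a0 /= add0r.
  apply/val_inj/polyP => -[|[|i]]; rewrite ?coef0 //.
  by rewrite nth_default // (leq_trans (size_dual g)).
have pp1 : (1 < p ^ 2)%N by rewrite -{1}(exp1n 2) ltn_exp2r.
have pp0 : (p ^ 2)%:R = 0 :> R by rewrite natrX expr2 mul0.
exists (natZp_morph pp1 pp0); apply: inj_card_bij; last by rewrite cR card_ord Zp_cast.
apply: rmorph_inj0 => n n0; apply: val_inj => /=.
have {n0} : (n : nat)%:R = 0 :> R := n0.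
have : (n < p * p)%N by rewrite mulnn -{2}(Zp_cast pp1) ltn_ord.
move: {n}(nat_of_ord n) => n npp.
(* The same argument on the two base-[p] digits of [n]: the low one lies in [M], so is 0; the high
   one then kills the nonzero element [p] of [M]. *)
rewrite {1}(divn_eq n p) natrD natrM => n0.
have b0 : (n %% p = 0)%N.
  apply/eqP; rewrite -leqn0 leqNgt; apply/negP=> b0.
  have /negP[] : (n %% p)%:R \notin M by apply: cop; rewrite b0 ltn_mod prime_gt0.
  by move/eqP: n0; rewrite addrC addr_eq0 => /eqP->; rewrite rpredN idealMr.
rewrite b0 addr0 in n0.
by rewrite (divn_eq n p) b0 (nat0 _ _ pM p0 _ n0) // ltn_divLR // prime_gt0.
Qed.

(** The order of [M] divides [p ^ 2]; it is not 1, as the nilpotent [x] lies in [M], and not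
    [p ^ 2], as [M] is proper. *)
Lemma card_ideal_of_nilpotent (R : finComNzRingType) (M : idealr R) p (x : R) :
  local_ring_with M -> prime p -> #|R| = (p ^ 2)%N -> x != 0 -> x * x = 0 ->
  #|M| = p /\ (#|R| %/ #|M|)%N = p.
Proof.
move=> locM p_pr cR x0 xx0.
suff Mp : #|M| = p by rewrite Mp cR -mulnn mulnK // prime_gt0.
have xM : x \in M.
  apply: contraNT x0 => /(local_unit locM)[y xy].
  by rewrite -[x]mulr1 -xy mulrA xx0 mul0r.
have : (#|M| %| p ^ 2)%N by rewrite -cR (card_ideal M) dvdn_mulr.
case/(dvdn_pfactor _ _ p_pr) => -[|[|[|//]]] _ //.
  by move/ideal_card1 => /(_ x); rewrite xM (negPf x0).
have := card_ideal M; rewrite cR => /[swap] -> /eqP.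
rewrite -{1}[(p ^ 2)%N]muln1 eqn_pmul2l ?expn_gt0 ?prime_gt0 // => /eqP q1.
by have := finNzRing_gt1 (residue_ring M); rewrite -q1.
Qed.

(** Each model contains a nonzero element of square zero, namely [p] or the class of ['X], which is
    pulled back to [R]. *)
Lemma local_ring_iso (R : finComNzRingType) (M : idealr R) p :
  local_ring_with M -> prime p ->
  ring_iso R 'Z_(p ^ 2) \/ ring_iso R {poly %/ ('X^2 : {poly 'Z_p})} ->
  #|M| = p /\ (#|R| %/ #|M|)%N = p.
Proof.
move=> locM p_pr; have p1 := prime_gt1 p_pr.
have pp1 : (1 < p ^ 2)%N by rewrite -{1}(exp1n 2) ltn_exp2r.
have key (B : comNzRingType) (y : B) :
    (forall f : R -> B, bijective f -> #|R| = (p ^ 2)%N) -> y != 0 ->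
    y * y = 0 -> ring_iso R B -> #|M| = p /\ (#|R| %/ #|M|)%N = p.
  move=> cB y0 yy0 [f bf]; have [g fK gK] := bf.
  apply: (@card_ideal_of_nilpotent _ _ _ (g y)) => //.
  - exact: cB bf.
  - by rewrite -(inj_eq (can_inj fK)) gK rmorph0.
  - by apply: (can_inj fK); rewrite rmorphM gK yy0 rmorph0.
case=> iso.
  apply: (@key 'Z_(p ^ 2) (p%:R)) iso.
    by move=> f /bij_eq_card ->; rewrite card_ord Zp_cast.
    apply/eqP=> /(congr1 val); rewrite /= val_Zp_nat // modn_small.
      by move=> p0; rewrite p0 in p1.
    by rewrite -mulnn ltn_Pmull // ltnW.
  by rewrite -natrM mulnn; apply: val_inj; rewrite /= val_Zp_nat // modnn.
have qXE : qpolyX ('X^2 : {poly 'Z_p}) = 'X :> {poly 'Z_p}.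
  by apply: qpolyXE; rewrite ?size_polyXn ?monicXn.
apply: (@key {poly %/ ('X^2 : {poly 'Z_p})} (qpolyX _)) iso.
- by move=> f /bij_eq_card ->; rewrite card_dual.
- by apply/eqP=> qX0; move: qXE; rewrite qX0 => /esym/eqP; rewrite polyX_eq0.
apply: val_inj; rewrite [LHS]poly_of_qpolyM qXE -[RHS]/(0 : {poly 'Z_p}).
by rewrite mk_monic_Xn -expr2 Pdiv.RingMonic.rmodpp ?monicXn.
Qed.

(** * Spectra of products *)

Section CayleyMatrix.
Variable V : finZmodType.
Implicit Types (S T U : {set V}) (v w : 'rV[algC]_#|V|).

(** Adjacency matrix of the Cayley digraph with connection set [S]; products of such matrices are
    convolutions of indicators. *)
Definition cayley_mx S : 'M[algC]_#|V| :=
  \matrix_(i, j) (enum_val i - enum_val j \in S)%:R.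

Lemma sum_enum_val (F : V -> algC) : \sum_(i < #|V|) F (enum_val i) = \sum_x F x.
Proof.
rewrite [RHS](reindex (@enum_val V V)) //=.
by apply: onW_bij; apply: enum_val_bij.
Qed.

Lemma cayley_mulE S T i j : (cayley_mx S *m cayley_mx T) i j =
  \sum_x (enum_val i - x \in S)%:R * (x - enum_val j \in T)%:R.
Proof.
rewrite mxE -[RHS]sum_enum_val; apply: eq_bigr => k _; by rewrite !mxE.
Qed.

Lemma cayley_mxC S T : cayley_mx S *m cayley_mx T = cayley_mx T *m cayley_mx S.
Proof.
apply/matrixP=> i j; rewrite !cayley_mulE.
set a := enum_val i; set b := enum_val j.
(* This reflection exchanges the differences [a - x] and [x - b]. *)
rewrite (reindex_inj (h := fun x => a + b - x)) /=; last first.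
  by move=> x y /addrI/oppr_inj.
apply: eq_bigr => x _; rewrite mulrC [a + b - x - b]addrAC addrK.
by rewrite opprB [a + _]addrCA opprD addNKr.
Qed.

Lemma sum_indicator (a : V) S : \sum_x (a - x \in S)%:R = #|S|%:R :> algC.
Proof.
rewrite -sum1_card natr_sum [RHS]big_mkcond /=.
rewrite (reindex_inj (h := fun x => a - x)) /=; last by move=> x y /addrI/oppr_inj.
by apply: eq_bigr => x _; rewrite subKr; case: (x \in S).
Qed.

(** When [a - x] is in [S], hence in the subgroup [T], the conditions that [x - b] and [a - b] be in
    [T] agree. *)
Lemma cayley_mx_sub S T : zmod_closed (mem T) -> S \subset T ->
  cayley_mx S *m cayley_mx T = #|S|%:R *: cayley_mx T.
Proof.
move=> [T0 TB] sST; apply/matrixP=> i j; rewrite cayley_mulE !mxE.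
set a := enum_val i; set b := enum_val j.
have TN x : x \in T -> - x \in T by move=> xT; rewrite -sub0r; apply: TB.
rewrite -(sum_indicator a) mulr_suml; apply: eq_bigr => x _.
have [/(subsetP sST) axT|] := boolP (a - x \in S); last by rewrite !mul0r.
congr (_ * (_ : bool)%:R); apply/idP/idP => H.
  have := TB _ _ H (TN _ axT); rewrite opprK addrC addrA subrK //.
by have := TB _ _ H axT; rewrite opprB addrC addrA subrK.
Qed.

Lemma cayley_mx_conv S T U :
  (forall d, \sum_y (d - y \in S)%:R * (y \in T)%:R = (d \in U)%:R :> algC) ->
  cayley_mx S *m cayley_mx T = cayley_mx U.
Proof.
move=> H; apply/matrixP=> i j; rewrite cayley_mulE !mxE -H.
rewrite (reindex_inj (addIr (enum_val j))) /=; apply: eq_bigr => y _.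
by rewrite addrK opprD addrAC addrA addrAC.
Qed.

Lemma row_cayley_mx (f : V -> algC) S j :
  ((\row_i f (enum_val i)) *m cayley_mx S) 0 j =
  \sum_x f x * (x - enum_val j \in S)%:R.
Proof. by rewrite mxE -[RHS]sum_enum_val; apply: eq_bigr => k _; rewrite !mxE. Qed.

Lemma sum_indicator_r (b : V) S : \sum_x (x - b \in S)%:R = #|S|%:R :> algC.
Proof.
rewrite -sum1_card natr_sum [RHS]big_mkcond /= (reindex_inj (addIr b)) /=.
by apply: eq_bigr => x _; rewrite addrK; case: (x \in S).
Qed.

Lemma row_cayley_mx_inv (f : V -> algC) S :
  (forall x b, x - b \in S -> f x = f b) ->
  (\row_i f (enum_val i)) *m cayley_mx S = #|S|%:R *: (\row_i f (enum_val i)).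
Proof.
move=> Hf; apply/rowP=> j; rewrite row_cayley_mx !mxE.
rewrite -(sum_indicator_r (enum_val j)) mulr_suml; apply: eq_bigr => x _.
by have [/Hf ->|] := boolP (x - enum_val j \in S); rewrite ?mul1r ?mulr1 ?mulr0 ?mul0r.
Qed.

(** Induction on [ss]. If the matrix of [S] kills the current vector, keep it; otherwise replace it
    by its image, an eigenvector for [#|S|] because the square of the matrix is [#|S|] times itself.
    Commutation preserves the other eigenvalues. *)
Lemma common_eigenvector (X : {set V}) l (ss : seq {set V}) v :
  (forall S, S \in ss -> zmod_closed (mem S)) ->
  v != 0 -> v *m cayley_mx X = l *: v ->
  exists2 w : 'rV_#|V|, w != 0 & w *m cayley_mx X = l *: w /\
    forall S, S \in ss -> exists b : bool, w *m cayley_mx S = (b * #|S|)%N%:R *: w.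
Proof.
elim: ss => [|S ss IH] zS v0 vX; first by exists v.
have [w w0 [wX wS]] := IH (fun T Ts => zS T (@mem_behead _ (S :: ss) T Ts)) v0 vX.
have [wS0|wS0] := eqVneq (w *m cayley_mx S) 0.
  exists w => //; split=> // T; rewrite inE => /orP[/eqP->|/wS//].
  by exists false; rewrite wS0 mul0n scale0r.
exists (w *m cayley_mx S) => //; split.
  by rewrite -mulmxA cayley_mxC mulmxA wX scalemxAl.
move=> T; rewrite inE => /orP[/eqP->|/wS[b wT]].
  exists true; rewrite mul1n -mulmxA cayley_mx_sub ?scalemxAr //.
  exact/zS/mem_head.
by exists b; rewrite -mulmxA cayley_mxC mulmxA wT scalemxAl.
Qed.

End CayleyMatrix.

(** * Eigenvalues of the unitary Cayley graph of a product *)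

Section ProductSpectrum.
Variables (s : nat) (hs : (1 < s)%N) (R : 'I_s -> finComNzRingType).
Variable M : forall i, idealr (R i).
Hypothesis hlocal : forall i, local_ring_with (M i).
Local Notation P := (ring_prod hs R).
Implicit Types (i j : 'I_s) (x y : P) (W : {set 'I_s}).

(** Elements invertible in the coordinates of [W] and zero elsewhere. They interpolate between 0,
    whose Cayley matrix is the identity, and the units of [P]. *)
Definition partial_units W : {set P} :=
  [set x : P | [forall j, if j \in W then x j \notin M j else x j == 0]].
(** The copy of R_i inside the product; [axis_ideal] is that of M_i. Their Cayley matrices are S_i
    and T_i. *)
Definition axis i : {set P} := [set x : P | [forall j, (j != i) ==> (x j == 0)]].
Definition axis_ideal i : {set P} := [set x in axis i | x i \in M i].
Definition axis_pt i (a : R i) : P := [ffun j => dfwith (fun j => 0 : R j) a j].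

Lemma prodBE x y j : (x - y) j = x j - y j.
Proof. by rewrite !ffunE. Qed.

Lemma prod0E j : (0 : P) j = 0.
Proof. by rewrite ffunE. Qed.

Lemma axis_ptE i (a : R i) : axis_pt a i = a.
Proof. by rewrite ffunE dfwith_in. Qed.

Lemma axis_pt_out i (a : R i) j : j != i -> axis_pt a j = 0.
Proof. by move=> ji; rewrite ffunE dfwith_out // eq_sym. Qed.

Lemma axisP i x : reflect (forall j, j != i -> x j = 0) (x \in axis i).
Proof.
rewrite inE; apply: (iffP forallP) => H j; first by move/(implyP (H j))/eqP.
by apply/implyP=> /H->.
Qed.

Lemma axis_closed i : zmod_closed (mem (axis i)).
Proof.
split; first by apply/axisP=> j _; rewrite prod0E.
move=> x y /axisP Hx /axisP Hy; apply/axisP=> j ji.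
by rewrite prodBE Hx // Hy // subrr.
Qed.

Lemma axis_ideal_closed i : zmod_closed (mem (axis_ideal i)).
Proof.
have [a0 aB] := axis_closed i.
split; first by rewrite inE [_ \in _]a0 prod0E rpred0.
move=> x y; rewrite !inE => /andP[Hx xM] /andP[Hy yM].
have := aB x y; rewrite !inE => /(_ Hx Hy) ->.
by rewrite prodBE rpredB.
Qed.

Lemma axis_ideal_sub i : axis_ideal i \subset axis i.
Proof. by apply/subsetP=> x; rewrite inE => /andP[]. Qed.

Lemma axis_inj i : {in axis i &, injective (fun x : P => x i)}.
Proof.
move=> x y /axisP Hx /axisP Hy xy; apply/ffunP=> j.
by have [->//|ji] := eqVneq j i; rewrite Hx ?Hy.
Qed.

Lemma axis_pt_axis i (a : R i) : axis_pt a \in axis i.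
Proof. by apply/axisP=> j; apply: axis_pt_out. Qed.

Lemma card_axis i : #|axis i| = #|R i|.
Proof.
rewrite -(card_in_imset (@axis_inj i)) -cardsT; congr #|pred_of_set _|.
apply/setP=> a; rewrite !inE; apply/imsetP; exists (axis_pt a).
  exact: axis_pt_axis.
by rewrite axis_ptE.
Qed.

Lemma card_axis_ideal i : #|axis_ideal i| = #|M i|.
Proof.
rewrite -(@card_in_imset _ _ (fun x : P => x i)).
  apply: eq_card => a; apply/imsetP/idP => [[x]|aM].
    by rewrite inE => /andP[_ xM] ->.
  by exists (axis_pt a); rewrite ?axis_ptE // inE axis_pt_axis axis_ptE.
by move=> x y /(subsetP (axis_ideal_sub i)) Hx /(subsetP (axis_ideal_sub i)) Hy; apply: axis_inj.
Qed.

Lemma partial_unitsP W x :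
  reflect (forall j, if j \in W then x j \notin M j else x j == 0) (x \in partial_units W).
Proof. by rewrite inE; apply: forallP. Qed.

Lemma partial_units1 i : cayley_mx (partial_units [set i]) =
  cayley_mx (axis i) - cayley_mx (axis_ideal i).
Proof.
apply/matrixP=> a b; rewrite !mxE; set x := _ - _.
have -> : (x \in partial_units [set i]) = (x \in axis i) && (x i \notin M i).
  apply/partial_unitsP/andP=> [H|[/axisP Hx xi] j].
    split; last by have := H i; rewrite set11.
    by apply/axisP=> j ji; have := H j; rewrite inE (negPf ji) => /eqP.
  by rewrite inE; have [->//|/Hx->] := eqVneq j i.
have -> : (x \in axis_ideal i) = (x \in axis i) && (x i \in M i) by rewrite inE.
by case: (x \in axis i); case: (x i \in M i); rewrite /= ?subrr ?subr0.
Qed.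

Lemma partial_units0 : cayley_mx (partial_units set0) = 1%:M.
Proof.
apply/matrixP=> a b; rewrite !mxE.
have -> : (enum_val a - enum_val b \in partial_units set0) = (a == b).
  rewrite -(inj_eq enum_val_inj) -subr_eq0; apply/partial_unitsP/eqP => [H|->].
    by apply/ffunP=> j; have := H j; rewrite inE prod0E => /eqP.
  by move=> j; rewrite inE prod0E.
by case: (a == b).
Qed.

Lemma partial_unitsU1 i W : i \notin W ->
  cayley_mx (partial_units W) *m cayley_mx (partial_units [set i]) =
  cayley_mx (partial_units (i |: W)).
Proof.
move=> iW; apply: cayley_mx_conv => d.
have ptd : axis_pt (d i) \in axis i := axis_pt_axis (d i).
(* As [i] is not in [W], the only possible summand of [d] on the axis is its [i]-th coordinate. *)
rewrite (bigD1 (axis_pt (d i))) //= [X in _ + X]big1 ?addr0 => [|y yd].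
  rewrite -natrM mulnb; congr (nat_of_bool _)%:R.
  apply/andP/partial_unitsP => [[/partial_unitsP H1 /partial_unitsP H2] j|H].
    rewrite !inE; have [->|ji] /= := eqVneq j i.
      by have := H2 i; rewrite set11 axis_ptE.
    by have := H1 j; rewrite prodBE axis_pt_out // subr0.
  split; apply/partial_unitsP => j; have := H j; rewrite !inE.
    have [->|ji] /= := eqVneq j i; last by rewrite prodBE axis_pt_out // subr0.
    by rewrite (negPf iW) prodBE axis_ptE subrr.
  have [->|ji] /= := eqVneq j i; first by rewrite axis_ptE.
  by rewrite axis_pt_out.
rewrite -natrM mulnb; case: andP => // -[/partial_unitsP H1 /partial_unitsP H2].
case/negP: yd; apply/eqP/ffunP => j; have [->|ji] := eqVneq j i.
  have := H1 i; rewrite (negPf iW) prodBE axis_ptE subr_eq0.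
  by move/eqP.
by rewrite axis_pt_out //; have := H2 j; rewrite inE (negPf ji) => /eqP.
Qed.

(** Invertibility in [P] is coordinatewise, and in a local ring it means lying outside the maximal
    ideal. *)
Lemma adjacency_cayley :
  adjacency (@unitary_cayley P) = cayley_mx (partial_units setT).
Proof.
apply/matrixP=> a b; rewrite !mxE /unitary_cayley; set x : P := _ - _.
congr (nat_of_bool _)%:R; clearbody x; apply/unitrPr/partial_unitsP => [[y xy] j|H].
  rewrite inE; apply/negP=> xM.
  have := ideal_mul_neq1 (y j) xM; rewrite (_ : x j * y j = 1) ?eqxx //.
  by move/ffunP: xy => /(_ j); rewrite !ffunE.
have inv j : exists z, x j * z == 1.
  have := H j; rewrite inE => /(local_unit (hlocal j))[z xz].
  by exists z; apply/eqP.
exists [ffun j => xchoose (inv j)]; apply/ffunP=> j; rewrite !ffunE.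
exact/eqP/(xchooseP (inv j)).
Qed.

(** Induction on a bound for [#|W|], splitting off one coordinate by [partial_unitsU1]; [W = setT]
    gives the adjacency matrix. *)
Lemma eigen_partial_units (lam : 'I_s -> algC) (w : 'rV_#|P|) W :
  (forall i, w *m cayley_mx (partial_units [set i]) = lam i *: w) ->
  w *m cayley_mx (partial_units W) = (\prod_(i in W) lam i) *: w.
Proof.
move=> Hw; move: {2}#|W| (leqnn #|W|) => n.
elim: n W => [|n IH] W Wn.
  have -> : W = set0 by apply/eqP; rewrite -cards_eq0 -leqn0.
  by rewrite partial_units0 mulmx1 big_set0 scale1r.
have [->|[i iW]] := set_0Vmem W.
  by rewrite partial_units0 mulmx1 big_set0 scale1r.
have D : i \notin W :\ i by rewrite !inE eqxx.
rewrite -{1}(setD1K iW) -partial_unitsU1 // mulmxA IH; last first.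
  by rewrite (cardsD1 i) iW in Wn.
by rewrite -scalemxAl Hw scalerA mulrC -(big_setD1 i iW).
Qed.

Let m i : nat := #|M i|.
Let q i : nat := (#|R i| %/ #|M i|)%N.

Lemma card_ringE i : #|R i| = (m i * q i)%N.
Proof. by rewrite (card_ideal (M i)) /q card_residueE. Qed.

(** The number of units of R_i. *)
Definition degree_factor i : nat := (m i * (q i).-1)%N.

Lemma degree_factorE i :
  (degree_factor i)%:R = #|axis i|%:R - #|axis_ideal i|%:R :> algC.
Proof.
rewrite card_axis card_axis_ideal card_ringE /degree_factor -/(m i).
rewrite -natrB; last by rewrite leq_pmulr // ltnW // card_residue_gt1.
by rewrite -{3}[m i]muln1 -mulnBr subn1.
Qed.

Lemma adjacency_eigenvalueP l : eigenvalue (adjacency (@unitary_cayley P)) l ->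
  exists2 lam : 'I_s -> algC, l = \prod_i lam i &
    forall i, [\/ lam i = (degree_factor i)%:R, lam i = - (m i)%:R | lam i = 0].
Proof.
rewrite adjacency_cayley => /eigenvalueP[v vX v0].
pose ss := [seq axis i | i <- enum 'I_s] ++ [seq axis_ideal i | i <- enum 'I_s].
have zss S : S \in ss -> zmod_closed (mem S).
  rewrite mem_cat => /orP[] /mapP[i _ ->]; [exact: axis_closed | exact: axis_ideal_closed].
have [w w0 [wX wS]] := common_eigenvector zss v0 vX.
have Hlam i : exists lam : algC, (w *m cayley_mx (partial_units [set i]) == lam *: w) &&
    [|| lam == (degree_factor i)%:R, lam == - (m i)%:R | lam == 0].
  have [|b wA] := wS (axis i); first by rewrite mem_cat map_f ?mem_enum.
  have [|c wI] := wS (axis_ideal i); first by rewrite mem_cat orbC map_f ?mem_enum.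
  exists ((b * #|axis i|)%N%:R - (c * #|axis_ideal i|)%N%:R).
  rewrite partial_units1 mulmxBr wA wI -scalerBl eqxx /=.
  case: b c wA wI => [] [] wA wI; rewrite ?mul1n ?mul0n ?subr0 ?sub0r.
  - by rewrite degree_factorE eqxx.
  (* S_i acting as [#|R i|] and T_i as 0 is impossible: T_i S_i = m_i S_i would give [w = 0]. *)
  - have := congr1 (mulmx w) (cayley_mx_sub (axis_closed i) (axis_ideal_sub i)).
    rewrite mulmxA wI mul0n scale0r mul0mx -scalemxAr wA mul1n scalerA => /esym/eqP.
    rewrite scaler_eq0 (negPf w0) orbF mulf_eq0 !pnatr_eq0 card_axis card_axis_ideal.
    by rewrite (gtn_eqF (ideal_gt0 _)) (gtn_eqF (ltnW (finNzRing_gt1 (R i)))).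
  - by rewrite card_axis_ideal eqxx orbT.
  - by rewrite eqxx !orbT.
pose lam i := xchoose (Hlam i).
have lamP i := xchooseP (Hlam i).
exists lam.
  have : w *m cayley_mx (partial_units setT) = (\prod_(i in setT) lam i) *: w.
    by apply: eigen_partial_units => i; case/andP: (lamP i) => /eqP.
  rewrite wX => /eqP; rewrite -subr_eq0 -scalerBl scaler_eq0 (negPf w0) orbF subr_eq0.
  by move/eqP->; apply: eq_bigl => i; rewrite inE.
move=> i; have /andP[_] := lamP i; rewrite -/(lam i) => /or3P[]/eqP->.
- by constructor 1.
- by constructor 2.
- by constructor 3.
Qed.

(** The constant vector has eigenvalue [#|S|] under every [cayley_mx S]; comparing this with the
    product formula counts the units. *)
Lemma regular_unitary_cayley :
  regular (@unitary_cayley P) (\prod_i degree_factor i).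
Proof.
pose w : 'rV[algC]_#|P| := \row_i (fun=> 1) (enum_val i : P).
have wS S : w *m cayley_mx S = #|S|%:R *: w by apply: row_cayley_mx_inv.
have := @eigen_partial_units (fun i => (degree_factor i)%:R) w setT.
rewrite wS => Hw.
have c : #|partial_units setT| = (\prod_i degree_factor i)%N.
  have /Hw/rowP/(_ (enum_rank 0)) : forall i,
      w *m cayley_mx (partial_units [set i]) = (degree_factor i)%:R *: w.
    by move=> i; rewrite partial_units1 mulmxBr !wS -scalerBl degree_factorE.
  rewrite !mxE !mulr1 -natr_prod => /eqP; rewrite eqr_nat => /eqP->.
  by apply: eq_bigl => i; rewrite inE.
have unitE (x : P) : (x \is a GRing.unit) = (x \in partial_units setT).
  move/matrixP: adjacency_cayley => /(_ (enum_rank x) (enum_rank 0)) /eqP.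
  rewrite !mxE !enum_rankK /unitary_cayley !subr0 eqr_nat.
  by do 2!case: (_ \in _).
move=> x; rewrite -c -(card_imset _ (subrI x)); apply: eq_card => y.
rewrite -unitE; apply/imsetP/idP => [[z]|yu].
  by rewrite inE => zu ->.
by exists (x - y); rewrite ?subKr // inE /unitary_cayley subKr.
Qed.

(** The eigenvector [f] is the difference of the indicators of M_j and 1 + M_j in coordinate [j]. It
    is constant along the other axes and modulo M_j, and its sum over each translate of axis [j] is
    0. *)
Lemma second_eigenvalue j : eigenvalue (adjacency (@unitary_cayley P))
  (- (m j)%:R * \prod_(i | i != j) (degree_factor i)%:R).
Proof.
rewrite adjacency_cayley.
pose f (x : P) : algC := (x j \in M j)%:R - (x j - 1 \in M j)%:R.
pose w : 'rV[algC]_#|P| := \row_i f (enum_val i).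
have Mshift (a b c : R j) : a - b \in M j -> (a + c \in M j) = (b + c \in M j).
  move=> ab; apply/idP/idP => H.
    by have := rpredB H ab; rewrite opprB addrC addrA subrK.
  by have := rpredD ab H; rewrite addrA subrK.
have finv (x b : P) : x j - b j \in M j -> f x = f b.
  move=> xb; rewrite /f (Mshift _ _ (-1) xb).
  by have := Mshift _ _ 0 xb; rewrite !addr0 => ->.
apply/eigenvalueP; exists w; last first.
  apply/eqP=> /rowP/(_ (enum_rank 0)); rewrite !mxE enum_rankK /f prod0E.
  by rewrite rpred0 sub0r rpredN idealr1 subr0 => /eqP; rewrite oner_eq0.
have -> : - (m j)%:R * \prod_(i | i != j) (degree_factor i)%:R =
    \prod_(i in setT) (if i == j then - (m j)%:R else (degree_factor i)%:R) :> algC.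
  rewrite [RHS](bigD1 j) ?inE //= eqxx; congr (_ * _).
  by apply: eq_big => [i|i /negPf->//]; rewrite inE.
apply: eigen_partial_units => i; rewrite partial_units1 mulmxBr.
have [->{i}|ij] := eqVneq i j; last first.
  rewrite !row_cayley_mx_inv -?scalerBl ?degree_factorE // => x b.
    rewrite inE => /andP[/axisP/(_ j)]; rewrite eq_sym prodBE => H _.
    by apply: finv; rewrite H ?rpred0.
  move/axisP/(_ j); rewrite eq_sym prodBE => H.
  by apply: finv; rewrite H ?rpred0.
rewrite (@row_cayley_mx_inv _ f (axis_ideal j)); last first.
  by move=> x b; rewrite inE prodBE => /andP[_ /finv].
have -> : w *m cayley_mx (axis j) = 0.
  apply/rowP=> k; rewrite row_cayley_mx [RHS]mxE; set b := enum_val k.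
  under eq_bigr do rewrite mulrBl; rewrite sumrB; apply/eqP; rewrite subr_eq0.
  (* Translation by 1 on axis [j] carries one indicator to the other and preserves the cosets of the
     axis. *)
  rewrite [X in _ == X](reindex_inj (addIr (axis_pt (1 : R j)))) /=.
  apply/eqP; apply: eq_bigr => x _; congr (_ * (nat_of_bool _)%:R).
    by rewrite ffunE axis_ptE addrK.
  apply/axisP/axisP => H i ij; have := H i ij;
    by rewrite !prodBE ffunE axis_pt_out // addr0.
by rewrite sub0r scaleNr card_axis_ideal.
Qed.

End ProductSpectrum.

(** * The Ramanujan bound *)

Lemma ler_2sqrtC (t r : nat) : (0 < r)%N ->
  (t%:R <= 2 * sqrtC (r%:R - 1) :> algC) = (t ^ 2 + 4 <= 4 * r)%N.
Proof.
move=> r0; have -> : r%:R - 1 = r.-1%:R :> algC by rewrite -subn1 natrB.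
rewrite -(@ler_pXn2r _ 2) ?nnegrE ?mulr_ge0 ?sqrtC_ge0 ?ler0n //.
rewrite exprMn sqrtCK -!natrX -natrM ler_nat; apply/idP/idP; lia.
Qed.

Section SqrtBound.
Variable q : nat.
Hypothesis q3 : (3 <= q)%N.
Let X : algC := sqrtC ((q%:R - 2) * q%:R).

Let Xge (n : nat) : (n%:R <= X) = (n ^ 2 <= (q - 2) * q)%N.
Proof.
rewrite /X -(natrB _ (ltnW q3)) -natrM -(@ler_pXn2r _ 2) ?nnegrE ?sqrtC_ge0 ?ler0n //.
by rewrite sqrtCK -natrX ler_nat.
Qed.

(** Since [(q - 2) * q = (q - 1) ^ 2 - 1], [X] is less than [q - 1] while [2 * X] is at least
    [2 * (q - 1) - 1]; the integer part of the bound is thus [4 * (q - 1) - 1]. *)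
Lemma ler_sqrt_bound (t : nat) :
  (t%:R <= 2 * (q%:R - 1 + X)) = (t < 4 * q.-1)%N.
Proof.
have qE : q%:R - 1 = q.-1%:R :> algC by rewrite -subn1 natrB // ltnW // ltnW.
rewrite qE; apply/idP/idP => [tX|t4].
  rewrite ltnNge; apply/negP=> t4.
  have : (4 * q.-1)%N%:R <= 2 * (q.-1%:R + X) by rewrite (le_trans _ tX) ?ler_nat.
  rewrite (_ : (4 * q.-1)%N%:R = 2 * (q.-1%:R + q.-1%:R)); last by rewrite natrM; ring.
  rewrite ler_pM2l ?ltr0n // lerD2l Xge; nia.
have : ((2 * q.-1).-1)%:R <= 2 * X.
  rewrite -(@ler_pXn2r _ 2) ?nnegrE ?mulr_ge0 ?sqrtC_ge0 ?ler0n //; last first.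
    by rewrite -(natrB _ (ltnW q3)) -natrM ler0n.
  rewrite exprMn sqrtCK -(natrB _ (ltnW q3)) -!natrX -!natrM ler_nat; nia.
move=> H; rewrite mulrDr; apply: le_trans (_ : (2 * q.-1)%N%:R + (2 * q.-1).-1%:R <= _).
  by rewrite -natrD ler_nat; lia.
by rewrite natrM lerD2l.
Qed.

(** The bound of [cond_f], where the maximal ideals have orders of product 2: subtract 1 and
    double. *)
Lemma ler_sqrt_bound_half (t : nat) : (0 < t)%N ->
  (t%:R <= q%:R + X) = (2 * t.-1 < 4 * q.-1)%N.
Proof.
move=> t0; rewrite -ler_sqrt_bound natrM ler_pM2l ?ltr0n //.
by rewrite -subn1 natrB // addrAC lerD2r.
Qed.

(** The bound of [cond_g]: subtract 1 from both sides. *)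
Lemma ler_sqrt_bound_pred (t : nat) : (0 < t)%N ->
  (t%:R <= 2 * (q%:R + X) - 1) = (t.-1 < 4 * q.-1)%N.
Proof.
move=> t0; rewrite -ler_sqrt_bound -subn1 natrB // lerBlDr.
by congr (_ <= _); ring.
Qed.

End SqrtBound.

Section Criterion.
Variables (s : nat) (hs : (1 < s)%N) (R : 'I_s -> finComNzRingType).
Variable M : forall i, idealr (R i).
Hypothesis hlocal : forall i, local_ring_with (M i).
Let m i : nat := #|M i|.
Let q i : nat := (#|R i| %/ #|M i|)%N.
Local Notation P := (ring_prod hs R).

Let deg := degree_factor M.
Let m_gt0 i : (0 < m i)%N := ideal_gt0 (M i).
Let q_gt1 i : (1 < q i)%N := card_residue_gt1 (M i).
Let deg_gt0 i : (0 < deg i)%N.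
Proof. by rewrite /deg /degree_factor -/(m i) -/(q i) muln_gt0 m_gt0 -subn1 subn_gt0 q_gt1. Qed.

Let m_deg i : (m i <= deg i)%N.
Proof. by rewrite leq_pmulr // -/(q i) -subn1 subn_gt0 q_gt1. Qed.

Lemma ramanujanP : ramanujan (@unitary_cayley P) <->
  forall j, (2 < q j)%N -> (\prod_i (m i * (q i).-1) < 4 * (q j).-1 ^ 2)%N.
Proof.
have -> : (\prod_i (m i * (q i).-1) = \prod_i deg i)%N by [].
have reg := @regular_unitary_cayley s hs R M hlocal.
set r := (\prod_i deg i)%N in reg *.
(* The absolute value of the eigenvalue obtained by changing the [j]-th factor from [deg j] to
   [- m j]. *)
pose t j := (m j * \prod_(i | i != j) deg i)%N.
have t_gt0 j : (0 < t j)%N by rewrite muln_gt0 m_gt0 prodn_gt0.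
have rE j : r = ((q j).-1 * t j)%N.
  by rewrite /r (bigD1 j) //= {1}/deg /degree_factor mulnA -/(m j) [(_ * m j)%N]mulnC.
have r_gt0 : (0 < r)%N by rewrite prodn_gt0.
split=> [[r' [reg' H]] j qj|H].
  have {reg'} r'E : r' = r by rewrite -(reg 0) -(reg' 0).
  rewrite {r'}r'E in H.
  have lE : - (m j)%:R * \prod_(i | i != j) (deg i)%:R = - (t j)%:R :> algC.
    by rewrite natrM natr_prod mulNr.
  have := H _ (@second_eigenvalue s hs R M hlocal j); rewrite lE.
  have := q_gt1 j; have := t_gt0 j; have := rE j.
  move: (t j) (q j) qj => {H lE} T Q qj rT T0 Q1.
  rewrite -subr_eq0 -opprD oppr_eq0 -natrD pnatr_eq0 eqr_opp eqr_nat normrN normr_nat.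
  rewrite ler_2sqrtC //.
  (* As [Q >= 3], [T] differs from [r], so the Ramanujan bound applies; with [r = (Q - 1) * T] it
     gives [T < 4 * (Q - 1)]. *)
  by move=> /(_ _ _) HH; have : (T ^ 2 + 4 <= 4 * r)%N; [apply: HH; nia|nia].
exists r; split=> // l /(@adjacency_eigenvalueP s hs R M hlocal)[lam ->{l} lamP] lr lNr.
have [/existsP[i /eqP li0]|] := boolP [exists i, lam i == 0].
  rewrite (bigD1 i) //= li0 mul0r normr0 mulr_ge0 ?sqrtC_ge0 ?subr_ge0 ?ler0n //.
  by rewrite ler1n.
rewrite negb_exists => /forallP lam0.
have lam_norm i : lam i = (deg i)%:R \/ lam i = - (m i)%:R.
  have := lam0 i; case: (lamP i) => [->|->|->]; rewrite ?eqxx //; by [left|right].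
have lam_le i : `|lam i| <= (deg i)%:R.
  by case: (lam_norm i) => ->; rewrite ?normrN normr_nat ?ler_nat.
have [/existsP[j /andP[/eqP lj qj]]|] :=
    boolP [exists j, (lam j == - (m j)%:R) && (2 < q j)%N].
  have ub : `|\prod_i lam i| <= (t j)%:R.
    rewrite (bigD1 j) //= normrM lj normrN normr_nat natrM natr_prod.
    by rewrite ler_wpM2l ?ler0n // normr_prod; apply: ler_prod => i _; rewrite normr_ge0 /=.
  apply: le_trans ub _; rewrite ler_2sqrtC //.
  have := H j qj; have := rE j; have := t_gt0 j; have := q_gt1 j.
  move: (t j) (q j) qj => T Q qj Q1 T0 -> Hr.
  have {Hr} : (T < 4 * Q.-1)%N by nia.
  nia.
(* A factor [- m i] now occurs only where [q i = 2], that is [deg i = m i]; so the eigenvalue, being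
   real, is [r] or [- r]. *)
rewrite negb_exists => /forallP Hj; exfalso.
have lam_eq i : `|lam i| = (deg i)%:R.
  case: (lam_norm i) => li; rewrite li ?normrN normr_nat //.
  have := Hj i; rewrite li eqxx /= -leqNgt => qi.
  congr _%:R; rewrite /deg /degree_factor -/(m i) -/(q i).
  by have := q_gt1 i; move: (q i) qi => [|[|[|]]] // _ _; rewrite muln1.
have : `|\prod_i lam i| == r%:R by rewrite normr_prod natr_prod; apply/eqP/eq_bigr.
rewrite real_eqr_norml ?(negPf lr) ?(negPf lNr) //.
by apply: rpred_prod => i _; case: (lam_norm i) => ->; rewrite ?rpredN realn.
Qed.

End Criterion.

(** * Classification *)

Lemma prod_nat_eq1 n (f : nat -> nat) :
  (forall k, (k < n)%N -> f k = 1%N) -> (\prod_(0 <= k < n) f k = 1)%N.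
Proof.
by move=> f1; rewrite big_nat_cond big1 // => k; rewrite andbT => /andP[_ /f1].
Qed.

Lemma prod_nat_gt0 n (f : nat -> nat) :
  (forall k, (k < n)%N -> (0 < f k)%N) -> (0 < \prod_(0 <= k < n) f k)%N.
Proof.
move=> f0; rewrite big_nat_cond prodn_cond_gt0 // => k.
by rewrite andbT => /andP[_ /f0].
Qed.

(** Case analysis on how many [q k] exceed 2, these being the last ones: none, one, two or three,
    each time using the bound at the smallest of them. Four or more are excluded. *)
Lemma classify_sorted (s : nat) (q m : nat -> nat) : (1 < s)%N ->
  (forall i j, (i <= j < s)%N -> (q i <= q j)%N) ->
  (forall k, (k < s)%N -> (1 < q k)%N) ->
  (0 < \prod_(0 <= k < s) m k)%N ->
  (forall j, (j < s)%N -> (2 < q j)%N ->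
    (\prod_(0 <= k < s) m k * \prod_(0 <= k < s) (q k).-1 < 4 * (q j).-1 ^ 2)%N) ->
  let pm := (\prod_(0 <= k < s) m k)%N in
  [\/ forall k, (k < s)%N -> q k = 2,
      [/\ forall k, (k < s - 1)%N -> q k = 2, (2 < q (s - 1))%N
        & (pm < 4 * (q (s - 1)%N).-1)%N],
      [/\ forall k, (k < s - 2)%N -> q k = 2, (2 < q (s - 2))%N
        & (pm * (q (s - 1)%N).-1 < 4 * (q (s - 2)%N).-1)%N]
    | [/\ (2 < s)%N, forall k, (k < s - 3)%N -> q k = 2, pm = 1%N
        & [\/ [/\ q (s - 3)%N = 3, q (s - 2)%N = 3 & q (s - 1)%N = 3],
              [/\ q (s - 3)%N = 3, q (s - 2)%N = 3 & q (s - 1)%N = 4]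
            | [/\ q (s - 3)%N = 4, q (s - 2)%N = 4 & q (s - 1)%N = 4]]]].
Proof.
move=> s1 q_sorted q_gt1; move: (\prod_(0 <= k < s) m k)%N => pm pm0 crit /=.
have low j : (j <= s)%N -> ((0 < j)%N -> (q j.-1 <= 2)%N) ->
    forall k, (k < j)%N -> q k = 2.
  move=> js qj k kj; have := q_gt1 k (leq_trans kj js).
  have := q_sorted k j.-1; have := qj (leq_ltn_trans (leq0n k) kj).
  by move=> qj2 le; move: (le ltac:(lia)) => ?; lia.
have lowprod j : (forall k, (k < j)%N -> q k = 2) ->
    (\prod_(0 <= k < j) (q k).-1 = 1)%N.
  by move=> qj; apply: prod_nat_eq1 => k /qj->.
case: s s1 => [|[|n]] // _ in q_sorted q_gt1 crit low *.
rewrite !subSS !subn0 in low *.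
have [q1|q1] := leqP (q n.+1) 2.
  by constructor 1; apply: low.
have q01 : (q n <= q n.+1)%N by apply: q_sorted; lia.
have [q2|q2] := leqP (q n) 2.
  have ql : forall k, (k < n.+1)%N -> q k = 2 by apply: low.
  constructor 2; split=> //; have := crit n.+1 (leqnn _) q1.
  rewrite big_nat_recr //= lowprod // mul1n; nia.
have := crit n (leqnSn _) q2.
case: n => [|n] in q_sorted q_gt1 crit low q1 q2 q01 *.
  rewrite big_nat_recr //= big_nat1 => c.
  by constructor 3; split=> //; nia.
rewrite !subSS !subn0 in low *.
have q12 : (q n <= q n.+1)%N by apply: q_sorted; lia.
have [q3|q3] := leqP (q n) 2.
  have ql : forall k, (k < n.+1)%N -> q k = 2.
    by apply: low => [|_] //; lia.
  rewrite big_nat_recr //= big_nat_recr //= lowprod // mul1n => c.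
  by constructor 3; split=> //; nia.
move=> _; have := crit n ltac:(lia) q3.
have key : ((0 < n)%N -> (q n.-1 <= 2)%N) ->
    (pm * (1 * (q n).-1 * (q n.+1).-1 * (q n.+2).-1) < 4 * (q n).-1 ^ 2)%N ->
    pm = 1%N /\ [\/ [/\ q n = 3, q n.+1 = 3 & q n.+2 = 3],
              [/\ q n = 3, q n.+1 = 3 & q n.+2 = 4]
            | [/\ q n = 4, q n.+1 = 4 & q n.+2 = 4]].
  move=> _; move: pm pm0 (q n) (q n.+1) (q n.+2) q3 q2 q1 q12 q01 {crit}.
  move=> p p0 [|a] [|b] [|c] //= a2 b2 c2 ab bc H.
  (* Here [a <= b <= c] are the three values of [q] minus 1, all at least 2. As [a <= b], this
     yields [p * c < 4], so [p = 1] and [c <= 3]. *)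
  have H1 : (p * (b * c) < 4 * a)%N by nia.
  have H2 : (p * c < 4)%N by nia.
  have c4 : (c <= 3)%N by nia.
  have p1 : p = 1%N by nia.
  split=> //; subst p.
  case: c c4 c2 bc H1 {H H2} => [|[|[|[|]]]] //.
    by move=> *; constructor 1; split; lia.
  move=> _ _ bc H1; have [a3|a3] : a = 2 \/ a = 3 by lia.
    by constructor 2; split; lia.
  by constructor 3; split; lia.
case: n => [|n] in q_sorted q_gt1 crit low q1 q2 q3 q01 q12 key *.
  rewrite 2?big_nat_recr //= big_nat1 => c.
  have [//||pm1 tri] := key; first by rewrite mul1n.
  by constructor 4; split; rewrite ?subSS ?subn0.
have q23 : (q n <= q n.+1)%N by apply: q_sorted; lia.
rewrite 3?big_nat_recr //=.
have [q4|q4] := leqP (q n) 2.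
  have ql : forall k, (k < n.+1)%N -> q k = 2.
    by apply: low => [|_] //; lia.
  rewrite lowprod // => c.
  have [] := key (fun=> q4) c.
  by constructor 4; split; rewrite ?subSS ?subn0.
rewrite big_nat_recr //=.
have : (0 < \prod_(0 <= k < n) (q k).-1)%N.
  by apply: prod_nat_gt0 => k kn; have := q_gt1 k ltac:(lia); lia.
move: (\prod_(0 <= k < n) (q k).-1)%N => pr pr0 H; exfalso; move: H.
apply/negP; rewrite -leqNgt.
move: (q n) (q n.+1) (q n.+2) (q n.+3) q1 q2 q3 q4 q01 q12 q23 pm0 {crit}.
move=> [|a] [|b] [|c] [|d] //= d2 c2 b2 a2 cd bc ab p0.
(* With four values above 2, the factors other than [b], [c], [d] contribute at least 2, and
   [c * d >= 2 * b]; the product reaches [4 * b ^ 2], against the bound at the third largest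
   value. *)
have : (1 <= pm * (pr * a))%N by rewrite !muln_gt0 p0 pr0; lia.
have : (2 <= pr * a)%N by nia.
move: (pr * a)%N => {pr0}e e2 _.
have : (2 <= pm * e)%N by nia.
rewrite !mulnA; move: (pm * e)%N => f f2.
have : (2 * b <= f * b)%N by nia.
have : (b * 2 <= c * d)%N by nia.
rewrite -[(f * b * c * d)%N]mulnA; nia.
Qed.

Lemma prod_eq_prime (I : finType) (f : I -> nat) p : prime p ->
  (\prod_i f i = p)%N ->
  exists2 i, f i = p & forall j, j != i -> f j = 1%N.
Proof.
move=> p_pr fp.
have dvdf i : (f i %| p)%N by rewrite -fp (bigD1 i) //= dvdn_mulr.
have [/existsP[i /eqP fi]|] := boolP [exists i, f i == p].
  exists i => // j ji; apply/eqP; rewrite -dvdn1.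
  have /eqP : (\prod_(k | k != i) f k = 1)%N.
    apply/eqP; rewrite -(eqn_pmul2l (prime_gt0 p_pr)) muln1 -{2}fp.
    by rewrite [X in _ == X](bigD1 i) //= fi.
  by rewrite (bigD1 j) //= muln_eq1 dvdn1 => /andP[].
rewrite negb_exists => /forallP Hf.
suff : (\prod_i f i = 1)%N by rewrite fp => p1; rewrite p1 in p_pr.
apply: big1 => i _; case/primeP: p_pr => _ /(_ _ (dvdf i)).
by rewrite (negPf (Hf i)) orbF => /eqP.
Qed.

Lemma prod_nat_last n (f : nat -> nat) : (0 < n)%N ->
  (\prod_(0 <= k < n) f k = \prod_(0 <= k < n - 1) f k * f (n - 1))%N.
Proof. by case: n => // n _; rewrite big_nat_recr //= subn1. Qed.

(** * The eight conditions against the numerical threshold *)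

Section Family.
Variables (s : nat) (hs : (1 < s)%N) (R : 'I_s -> finComNzRingType).
Variable M : forall i, idealr (R i).
Hypothesis hlocal : forall i, local_ring_with (M i).

(** Indexed by [nat] to allow arithmetic on indices; beyond [s] the default is the value at index
    1. *)
Definition ideal_card k : nat := #|M (insubd (Ordinal hs) k)|.
Definition residue_card k : nat :=
  (#|R (insubd (Ordinal hs) k)| %/ #|M (insubd (Ordinal hs) k)|)%N.
(** The numerical side of [ramanujanP], as a property of the family that can be compared across
    renumberings. *)
Definition below_threshold := forall j, (2 < #|R j| %/ #|M j|)%N ->
  (\prod_i (#|M i| * (#|R i| %/ #|M i|).-1) < 4 * (#|R j| %/ #|M j|).-1 ^ 2)%N.
Local Notation m := ideal_card.
Local Notation q := residue_card.
Local Notation prodm := (\prod_(0 <= k < s) m k)%N.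
Local Notation prodq := (\prod_(0 <= k < s) (q k).-1)%N.

Lemma ideal_cardE (i : 'I_s) : m i = #|M i|.
Proof. by rewrite /m valKd. Qed.

Lemma residue_cardE (i : 'I_s) : q i = (#|R i| %/ #|M i|)%N.
Proof. by rewrite /q valKd. Qed.

Lemma ideal_card_gt0 k : (0 < m k)%N.
Proof. exact: ideal_gt0. Qed.

Lemma residue_card_gt1 k : (1 < q k)%N.
Proof. exact: card_residue_gt1. Qed.

Lemma prod_ideal_card : (prodm = \prod_i #|M i|)%N.
Proof. by rewrite big_mkord; apply: eq_bigr => i _; rewrite ideal_cardE. Qed.

Lemma prod_degree : (\prod_i (#|M i| * (#|R i| %/ #|M i|).-1) = prodm * prodq)%N.
Proof.
rewrite big_split /= prod_ideal_card big_mkord; congr (_ * _)%N.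
by apply: eq_bigr => i _; rewrite residue_cardE.
Qed.

(** The threshold grows with [q j], so it is enough to test a lower bound [b] of the values above
    2. *)
Lemma below_threshold_intro b : (prodm * prodq < 4 * b.-1 ^ 2)%N ->
  (forall k, (k < s)%N -> (2 < q k)%N -> (b <= q k)%N) -> below_threshold.
Proof.
move=> Hb Hq j; rewrite prod_degree -residue_cardE => qj.
apply: leq_trans Hb _; have := Hq j (ltn_ord j) qj.
rewrite leq_mul2l leq_exp2r //; lia.
Qed.

Lemma below_threshold_elim j : below_threshold -> (j < s)%N -> (2 < q j)%N ->
  (prodm * prodq < 4 * (q j).-1 ^ 2)%N.
Proof.
move=> H js; have := H (Ordinal js); rewrite prod_degree.
by rewrite -(residue_cardE (Ordinal js)); apply.
Qed.

Lemma iso_Fq_cards k (ks : (k < s)%N) c :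
  iso_Fq (R (Ordinal ks)) c -> q k = c /\ m k = 1%N.
Proof.
move=> /(iso_Fq_ideal (M (Ordinal ks)))[m1 qc].
by rewrite -[k]/(val (Ordinal ks)) residue_cardE ideal_cardE.
Qed.

Lemma iso_residue_card k (ks : (k < s)%N) c :
  iso_Fq {ideal_quot (M (Ordinal ks))} c -> q k = c.
Proof.
by move=> /iso_Fq_residue; rewrite -(residue_cardE (Ordinal ks)).
Qed.

Lemma local_ring_iso_cards k (ks : (k < s)%N) p : prime p ->
  ring_iso (R (Ordinal ks)) 'Z_(p ^ 2) \/
  ring_iso (R (Ordinal ks)) {poly %/ ('X^2 : {poly 'Z_p})} ->
  q k = p /\ m k = p.
Proof.
move=> p_pr /(local_ring_iso (hlocal (Ordinal ks)) p_pr)[mp qp].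
by rewrite -[k]/(val (Ordinal ks)) residue_cardE ideal_cardE.
Qed.

Lemma cards_iso_Fq (i : 'I_s) c : q i = c -> m i = 1%N -> iso_Fq (R i) c.
Proof.
rewrite residue_cardE ideal_cardE => <- m1; exact: field_iso.
Qed.

Lemma card_iso_residue (i : 'I_s) c : q i = c -> iso_Fq {ideal_quot (M i)} c.
Proof. rewrite residue_cardE => <-; exact: residue_iso. Qed.

Lemma prime_power_residue_card k : prime_power (q k).
Proof. exact: prime_power_residue. Qed.

Lemma prime_ideal_card_residue k p : prime p -> m k = p -> q k = p.
Proof. by move=> p_pr; apply: prime_ideal_residue. Qed.

Lemma prodm1 : (forall k, (k < s)%N -> m k = 1%N) -> prodm = 1%N.
Proof. exact: prod_nat_eq1. Qed.

Lemma prodq1 : (forall k, (k < s - 1)%N -> q k = 2) -> prodq = (q (s - 1)).-1.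
Proof.
move=> q2; rewrite prod_nat_last; last by lia.
by rewrite prod_nat_eq1 ?mul1n // => k /q2->.
Qed.

Lemma prodq2 : (forall k, (k < s - 2)%N -> q k = 2) ->
  prodq = ((q (s - 2)).-1 * (q (s - 1)).-1)%N.
Proof.
move=> q2; do 2?[rewrite prod_nat_last; last by lia].
rewrite -!subnDA prod_nat_eq1 ?mul1n // => k /q2->//.
Qed.

Lemma prodq3 : (2 < s)%N -> (forall k, (k < s - 3)%N -> q k = 2) ->
  prodq = ((q (s - 3)).-1 * (q (s - 2)).-1 * (q (s - 1)).-1)%N.
Proof.
move=> s2 q2; do 3?[rewrite prod_nat_last; last by lia].
rewrite -!subnDA prod_nat_eq1 ?mul1n // => k /q2->//.
Qed.

Lemma cond_a_below : cond_a M -> below_threshold.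
Proof.
by move=> H j; rewrite (iso_Fq_residue (H j)).
Qed.

Lemma cond_b_below : cond_b R -> below_threshold.
Proof.
move=> [s2 H].
have lo k : (k < s - 3)%N -> q k = 2 /\ m k = 1%N.
  move=> ks; have ks' : (k < s)%N by lia.
  by apply: (iso_Fq_cards (ks := ks')); apply: (H _).1 => /=; lia.
have hi k : (s - 3 <= k < s)%N -> q k = 3 /\ m k = 1%N.
  move=> /andP[ks ks'].
  by apply: (iso_Fq_cards (ks := ks')); apply: (H _).2 => /=; lia.
(* The inequality to check is 8 < 16. *)
apply: (@below_threshold_intro 3) => //.
rewrite prodm1 => [|k ks]; last first.
  by have [/lo[]//|ks'] := ltnP k (s - 3); apply: (hi _ _).2; lia.
rewrite prodq3 // => [|k /lo[]//].
by rewrite (hi (s - 3)%N ltac:(lia)).1 (hi (s - 2)%N ltac:(lia)).1 (hi (s - 1)%N ltac:(lia)).1.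
Qed.

Lemma cond_c_below : cond_c R -> below_threshold.
Proof.
move=> [s2 H].
have lo k : (k < s - 3)%N -> q k = 2 /\ m k = 1%N.
  move=> ks; have ks' : (k < s)%N by lia.
  by apply: (iso_Fq_cards (ks := ks')); have [h _ _] := H (Ordinal ks'); apply: h => /=; lia.
have hi k : (s - 3 <= k < s - 1)%N -> q k = 3 /\ m k = 1%N.
  move=> /andP[ks ks1]; have ks' : (k < s)%N by lia.
  by apply: (iso_Fq_cards (ks := ks')); have [_ h _] := H (Ordinal ks'); apply: h => /=; lia.
have top : q (s - 1) = 4 /\ m (s - 1) = 1%N.
  have ks' : (s - 1 < s)%N by lia.
  by apply: (iso_Fq_cards (ks := ks')); have [_ _ h] := H (Ordinal ks'); apply: h => /=; lia.
(* The inequality to check is 12 < 16. *)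
apply: (@below_threshold_intro 3) => //.
rewrite prodm1 => [|k ks]; last first.
  have [/lo[]//|ks'] := ltnP k (s - 3).
  have [ks1|ks1] := ltnP k (s - 1); first by apply: (hi _ _).2; lia.
  by rewrite (_ : k = s - 1)%N ?top.2 //; lia.
rewrite prodq3 // => [|k /lo[]//].
by rewrite (hi (s - 3)%N ltac:(lia)).1 (hi (s - 2)%N ltac:(lia)).1 top.1.
Qed.

Lemma cond_d_below : cond_d R -> below_threshold.
Proof.
move=> [s2 H].
have lo k : (k < s - 3)%N -> q k = 2 /\ m k = 1%N.
  move=> ks; have ks' : (k < s)%N by lia.
  by apply: (iso_Fq_cards (ks := ks')); apply: (H _).1 => /=; lia.
have hi k : (s - 3 <= k < s)%N -> q k = 4 /\ m k = 1%N.
  move=> /andP[ks ks'].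
  by apply: (iso_Fq_cards (ks := ks')); apply: (H _).2 => /=; lia.
(* The inequality to check is 27 < 36. *)
apply: (@below_threshold_intro 4) => [|k ks qk]; last first.
  have [/lo[q2]|ks'] := ltnP k (s - 3); first by rewrite q2 in qk.
  by rewrite (hi k _).1 //; lia.
rewrite prodm1 => [|k ks]; last first.
  by have [/lo[]//|ks'] := ltnP k (s - 3); apply: (hi _ _).2; lia.
rewrite prodq3 // => [|k /lo[]//].
by rewrite (hi (s - 3)%N ltac:(lia)).1 (hi (s - 2)%N ltac:(lia)).1 (hi (s - 1)%N ltac:(lia)).1.
Qed.

Lemma cond_e_below : cond_e R -> below_threshold.
Proof.
move=> H.
have lo k : (k < s - 2)%N -> q k = 2 /\ m k = 1%N.
  move=> ks; have ks' : (k < s)%N by lia.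
  by apply: (iso_Fq_cards (ks := ks')); have [h _ _] := H (Ordinal ks'); apply: h => /=; lia.
have hi : q (s - 2) = 3 /\ m (s - 2) = 1%N.
  have ks' : (s - 2 < s)%N by lia.
  by apply: (iso_Fq_cards (ks := ks')); have [_ h _] := H (Ordinal ks'); apply: h => /=; lia.
have top : q (s - 1) = 3 /\ m (s - 1) = 3.
  have ks' : (s - 1 < s)%N by lia.
  apply: (local_ring_iso_cards (ks := ks')) => //.
  by have [_ _ h] := H (Ordinal ks'); apply: h => /=; lia.
(* The degree is 12, the factor 3 coming from the maximal ideal of the last ring. *)
apply: (@below_threshold_intro 3) => //.
rewrite prodq2 => [|k /lo[]//]; do 2?[rewrite prod_nat_last; last by lia].
rewrite -!subnDA prod_nat_eq1 => [|k /lo[]//].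
by rewrite hi.1 hi.2 top.1 top.2.
Qed.

Lemma cond_f_below : cond_f R -> below_threshold.
Proof.
move=> [q1 [q2 [_ [q1_3 q2_3] q12 bound H]]].
(* For [s = 2] the first factor is also the one at [s - 1], so its maximal ideal would have both
   order 2 and order 1. *)
have s_gt2 : (2 < s)%N.
  rewrite ltnNge; apply/negP=> s2; have k0 : (0 < s)%N by lia.
  have [h _ g _] := H (Ordinal k0).
  have [_ m2] : q 0 = 2 /\ m 0 = 2 by apply: (local_ring_iso_cards (ks := k0)) => //; apply: h.
  have [_] : q 0 = q1 /\ m 0 = 1%N by apply: (iso_Fq_cards (ks := k0)); apply: g => /=; lia.
  by rewrite m2.
have bot : q 0 = 2 /\ m 0 = 2.
  have k0 : (0 < s)%N by lia.
  by apply: (local_ring_iso_cards (ks := k0)) => //; have [h _ _ _] := H (Ordinal k0); apply: h.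
have lo k : (0 < k < s - 2)%N -> q k = 2 /\ m k = 1%N.
  move=> ks; have ks' : (k < s)%N by lia.
  by apply: (iso_Fq_cards (ks := ks')); have [_ h _ _] := H (Ordinal ks'); apply: h => /=; lia.
have hi : q (s - 2) = q1 /\ m (s - 2) = 1%N.
  have ks' : (s - 2 < s)%N by lia.
  by apply: (iso_Fq_cards (ks := ks')); have [_ _ h _] := H (Ordinal ks'); apply: h => /=; lia.
have top : q (s - 1) = q2 /\ m (s - 1) = 1%N.
  have ks' : (s - 1 < s)%N by lia.
  by apply: (iso_Fq_cards (ks := ks')); have [_ _ _ h] := H (Ordinal ks'); apply: h => /=; lia.
rewrite ler_sqrt_bound_half // in bound; last by lia.
have lo2 k : (k < s - 2)%N -> q k = 2.
  by case: k => [|k] ks; [exact: bot.1 | apply: (lo _ _).1; lia].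
apply: (@below_threshold_intro q1) => [|k ks qk].
  rewrite prodq2 // hi.1 top.1 (_ : prodm = 2); first by nia.
  rewrite big_ltn ?bot.2; last by lia.
  rewrite big_nat_cond big1 // => k; rewrite andbT => /andP[k0 ks].
  have [ks2|ks2] := ltnP k (s - 2); first by apply: (lo _ _).2; lia.
  have [->|->] : k = (s - 2)%N \/ k = (s - 1)%N by lia.
    exact: hi.2.
  exact: top.2.
have [/lo2 q22|ks2] := ltnP k (s - 2); first by rewrite q22 in qk.
have [->|->] : k = (s - 2)%N \/ k = (s - 1)%N by lia.
  by rewrite hi.1.
by rewrite top.1.
Qed.

Lemma cond_g_below : cond_g R -> below_threshold.
Proof.
move=> [q1 [q2 [_ [q1_3 q2_3] q12 bound H]]].
have lo k : (k < s - 2)%N -> q k = 2 /\ m k = 1%N.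
  move=> ks; have ks' : (k < s)%N by lia.
  by apply: (iso_Fq_cards (ks := ks')); have [h _ _] := H (Ordinal ks'); apply: h => /=; lia.
have hi : q (s - 2) = q1 /\ m (s - 2) = 1%N.
  have ks' : (s - 2 < s)%N by lia.
  by apply: (iso_Fq_cards (ks := ks')); have [_ h _] := H (Ordinal ks'); apply: h => /=; lia.
have top : q (s - 1) = q2 /\ m (s - 1) = 1%N.
  have ks' : (s - 1 < s)%N by lia.
  by apply: (iso_Fq_cards (ks := ks')); have [_ _ h] := H (Ordinal ks'); apply: h => /=; lia.
rewrite ler_sqrt_bound_pred // in bound; last by lia.
apply: (@below_threshold_intro q1) => [|k ks qk].
  rewrite prodq2 => [|k /lo[]//]; rewrite hi.1 top.1 prodm1; first by nia.
  move=> k ks; have [/lo[]//|ks2] := ltnP k (s - 2).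
  have [->|->] : k = (s - 2)%N \/ k = (s - 1)%N by lia.
    exact: hi.2.
  exact: top.2.
have [/lo[q22]|ks2] := ltnP k (s - 2); first by rewrite q22 in qk.
have [->|->] : k = (s - 2)%N \/ k = (s - 1)%N by lia.
  by rewrite hi.1.
by rewrite top.1.
Qed.

Lemma cond_h_below : cond_h M -> below_threshold.
Proof.
move=> [q0 [_ q3 bound H]].
have lo k : (k < s - 1)%N -> q k = 2.
  move=> ks; have ks' : (k < s)%N by lia.
  by apply: (iso_residue_card (ks := ks')); apply: (H _).1 => /=; lia.
have top : q (s - 1) = q0.
  have ks' : (s - 1 < s)%N by lia.
  by apply: (iso_residue_card (ks := ks')); apply: (H _).2 => /=; lia.
rewrite ler_sqrt_bound // -prod_ideal_card in bound.
apply: (@below_threshold_intro q0) => [|k ks qk].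
  by rewrite prodq1 // top; nia.
have [/lo q2|ks1] := ltnP k (s - 1); first by rewrite q2 in qk.
by rewrite (_ : k = s - 1)%N ?top //; lia.
Qed.

(** The last two hypotheses place the factor that is not a field where [cond_f] and [cond_e] expect
    it; a renumbering provides them. *)
Lemma below_threshold_cond : residue_sorted M -> below_threshold ->
  (prodm = 2 -> m 0 = 2) ->
  (prodm = 3 -> q (s - 1) = 3 -> m (s - 1) = 3) ->
  cond_a M \/ cond_b R \/ cond_c R \/ cond_d R \/
  cond_e R \/ cond_f R \/ cond_g R \/ cond_h M.
Proof.
move=> sorted below place2 place3.
have sortedN i j : (i <= j < s)%N -> (q i <= q j)%N.
  move=> /andP[ij js]; have is_ : (i < s)%N by lia.
  rewrite -[i]/(val (Ordinal is_)) -[j]/(val (Ordinal js)) !residue_cardE.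
  exact: sorted.
have pm0 : (0 < prodm)%N by apply: prod_nat_gt0 => k _; apply: ideal_card_gt0.
have m_dvd k : (k < s)%N -> (m k %| prodm)%N.
  move=> ks; rewrite -[k]/(val (Ordinal ks)) big_mkord (bigD1 (Ordinal ks)) //=.
  exact: dvdn_mulr.
have uniq_m k j : (k < s)%N -> (j < s)%N -> m k = prodm -> j != k -> m j = 1%N.
  move=> ks js mk jk.
  have := mk; rewrite big_mkord (bigD1 (Ordinal ks)) //= (bigD1 (Ordinal js)) //=.
  move=> /eqP; rewrite -{1}[m k]muln1 eqn_pmul2l ?ideal_card_gt0 // eq_sym.
  by rewrite muln_eq1 => /andP[/eqP].
have := @classify_sorted s q m hs sortedN (fun k _ => residue_card_gt1 k) pm0
  (fun j => @below_threshold_elim j below).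
case=> [q2|[lo q3 bound]|[lo q3 bound]|[s2 lo pm1 tri]].
- left=> i; apply: card_iso_residue; exact: q2.
- do 7!right; exists (q (s - 1)); split=> //; first exact: prime_power_residue_card.
    by rewrite ler_sqrt_bound // -prod_ideal_card.
  move=> i; split=> [i1|i1]; apply: card_iso_residue; first by apply: lo; lia.
  by congr q; lia.
- have q12 : (q (s - 2) <= q (s - 1))%N by apply: sortedN; lia.
  (* From [bound] and [q (s - 2) <= q (s - 1)] follows [prodm < 4]; the three values lead to
     [cond_g], [cond_f] and [cond_e]. *)
  have [pm1|[pm2|pm3]] : prodm = 1%N \/ prodm = 2 \/ prodm = 3.
    have : (prodm < 4)%N by have := residue_card_gt1 (s - 2); nia.
    by move: prodm pm0 => [|[|[|[|]]]] //; auto.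
  + have m1 k : (k < s)%N -> m k = 1%N.
      by move=> /m_dvd; rewrite pm1 dvdn1 => /eqP.
    do 6!right; left; exists (q (s - 2)), (q (s - 1)).
    rewrite pm1 mul1n in bound.
    split=> //; try by split; [exact: prime_power_residue_card | exact: prime_power_residue_card].
    * by split=> //; lia.
    * rewrite ler_sqrt_bound_pred //; lia.
    move=> i; split=> i1; apply: cards_iso_Fq; rewrite ?m1 //; first by apply: lo; lia.
      by congr q; lia.
    by congr q; lia.
  + have m0 := place2 pm2; have q0 := prime_ideal_card_residue (isT : prime 2) m0.
    have s2 : (2 < s)%N.
      rewrite ltnNge; apply/negP=> s2; move: q3.
      by rewrite (_ : s - 2 = 0)%N ?q0 //; lia.
    have m1 k : (0 < k < s)%N -> m k = 1%N.
      by move=> ks; apply: (uniq_m 0%N); rewrite ?pm2 //; lia.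
    do 5!right; left; exists (q (s - 2)), (q (s - 1)).
    rewrite pm2 in bound.
    split=> //; try by split; [exact: prime_power_residue_card | exact: prime_power_residue_card].
    * by split=> //; lia.
    * by rewrite ler_sqrt_bound_half //; lia.
    move=> i; split=> i1.
    * apply: (@local_prime_ideal _ (M i) 2) => //.
      by rewrite -ideal_cardE (_ : nat_of_ord i = 0%N) //; lia.
    * by apply: cards_iso_Fq; [apply: lo | apply: m1]; lia.
    * by apply: cards_iso_Fq; [congr q | apply: m1]; lia.
    * by apply: cards_iso_Fq; [congr q | apply: m1]; lia.
  + have [i mi _] : exists2 i : 'I_s, #|M i| = 3 & forall j, j != i -> #|M j| = 1%N.
      by apply: prod_eq_prime => //; rewrite -prod_ideal_card.
    have qi : q i = 3 by apply: prime_ideal_card_residue; rewrite ?ideal_cardE.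
    (* The factor with ideal of order 3 has residue cardinal 3, so it sits at [s - 2] or later and
       sortedness bounds [q (s - 2)]; [bound] then forces [q (s - 1) = 3]. *)
    have q1 : q (s - 2) = 3.
      have : (q (s - 2) <= q i)%N.
        apply: sortedN; rewrite ltn_ord andbT leqNgt; apply/negP=> /lo.
        by rewrite qi.
      by rewrite qi; lia.
    have q2 : q (s - 1) = 3 by rewrite pm3 q1 in bound; lia.
    have mt := place3 pm3 q2.
    have m1 k : (k < s - 1)%N -> m k = 1%N.
      by move=> ks; apply: (uniq_m (s - 1)%N); rewrite ?pm3 //; lia.
    do 4!right; left=> j; split=> j1.
    * by apply: cards_iso_Fq; [apply: lo | apply: m1]; lia.
    * apply: cards_iso_Fq; last by apply: m1; lia.
      by rewrite (_ : nat_of_ord j = s - 2)%N //; lia.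
    * apply: (@local_prime_ideal _ (M j) 3) => //.
      by rewrite -ideal_cardE (_ : nat_of_ord j = s - 1)%N //; lia.
have m1 k : (k < s)%N -> m k = 1%N.
  by move=> /m_dvd; rewrite pm1 dvdn1 => /eqP.
have loF (i : 'I_s) : (i.+1 <= s - 3)%N -> iso_Fq (R i) 2.
  by move=> i3; apply: cards_iso_Fq; [apply: lo | apply: m1].
have hiF (i : 'I_s) c : q i = c -> iso_Fq (R i) c.
  by move=> qi; apply: cards_iso_Fq => //; apply: m1.
have rng k : (s - 2 <= k.+1 <= s)%N -> [\/ k = s - 3, k = s - 2 | k = s - 1]%N.
  move=> ks; have [->|[->|->]] : (k = s - 3 \/ k = s - 2 \/ k = s - 1)%N by lia.
  - by constructor 1.
  - by constructor 2.
  - by constructor 3.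
case: tri => -[qa qb qc]; right.
- left; split=> // i; split=> [|i1]; first exact: loF.
  by apply: hiF; case: (rng i i1) => ->.
- right; left; split=> // i; split=> [|i1|i1]; first exact: loF.
    by apply: hiF; case: (rng i) => [|->|->|is_] //; lia.
  by apply: hiF; rewrite (_ : nat_of_ord i = s - 1)%N //; lia.
- right; right; left; split=> // i; split=> [|i1]; first exact: loF.
  by apply: hiF; case: (rng i i1) => ->.
Qed.

End Family.

(** * Renumbering factors of equal residue cardinal *)

Section Renumbering.
Variables (s : nat) (hs : (1 < s)%N) (R : 'I_s -> finComNzRingType).
Variable M : forall i, idealr (R i).
Hypothesis hlocal : forall i, local_ring_with (M i).
Hypothesis hsorted : residue_sorted M.
Let q i : nat := (#|R i| %/ #|M i|)%N.

Lemma below_threshold_perm (sigma : 'S_s) :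
  below_threshold (fun i => M (sigma i)) <-> below_threshold M.
Proof.
have prodE : (\prod_i (#|M (sigma i)| * (#|R (sigma i)| %/ #|M (sigma i)|).-1) =
    \prod_i (#|M i| * (#|R i| %/ #|M i|).-1))%N.
  by rewrite [RHS](reindex_inj (@perm_inj _ sigma)).
split=> H j; last by rewrite prodE; apply: H.
by have := H (sigma^-1%g j); rewrite prodE permKV.
Qed.

Lemma sorted_perm (sigma : 'S_s) :
  (forall i, q (sigma i) = q i) -> residue_sorted (fun i => M (sigma i)).
Proof. by move=> qs i j ij; rewrite -!/(q _) !qs; apply: hsorted. Qed.

(** If the product is a prime [p], exactly one maximal ideal is nonzero, and its ring has residue
    cardinal [p]. A transposition with a factor of the same residue cardinal moves it into place. *)
Lemma exists_placement (i0 i1 : 'I_s) : i0 = 0%N :> nat ->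
  exists2 sigma : 'S_s, forall i, q (sigma i) = q i &
    ((\prod_i #|M i|)%N = 2 -> #|M (sigma i0)| = 2) /\
    ((\prod_i #|M i|)%N = 3 -> q i1 = 3 -> #|M (sigma i1)| = 3).
Proof.
move=> i00.
have swap (i j : 'I_s) : q i = q j -> forall k, q (tperm i j k) = q k.
  by move=> qij k; case: tpermP => [->|->|].
have [p2|p2] := eqVneq (\prod_i #|M i|)%N 2.
  have [i mi _] := prod_eq_prime (isT : prime 2) p2.
  have qi : q i = 2 by apply: prime_ideal_residue.
  exists (tperm i0 i); last by rewrite tpermL mi p2.
  (* The first residue cardinal is the smallest and at least 2, hence equal to 2. *)
  apply: swap; apply/eqP; rewrite eqn_leq {2}qi (card_residue_gt1 (M i0)) andbT.
  by apply: hsorted; rewrite i00.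
have [p3|p3] := eqVneq (\prod_i #|M i|)%N 3; last first.
  exists 1%g => [i|]; first by rewrite perm1.
  by split=> pe; [rewrite pe in p2 | rewrite pe in p3].
have [i mi _] := prod_eq_prime (isT : prime 3) p3.
have qi : q i = 3 by apply: prime_ideal_residue.
have [q3|q3] := eqVneq (q i1) 3.
  exists (tperm i1 i); last by rewrite tpermL mi p3.
  by apply: swap; rewrite q3 qi.
exists 1%g => [i'|]; first by rewrite perm1.
by split=> [pe|_ qe]; [rewrite pe in p3 | rewrite qe in q3].
Qed.

End Renumbering.

Theorem theorem3p2 (s : nat) (hs : (1 < s)%N)
  (R : 'I_s -> finComNzRingType) (M : forall i, idealr (R i))
  (hlocal : forall i, local_ring_with (M i))
  (hsorted : residue_sorted M) :
  ramanujan (@unitary_cayley (ring_prod hs R)) <->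
  exists sigma : 'S_s,
    let R' := fun i : 'I_s => R (sigma i) in
    let M' : forall i : 'I_s, idealr (R' i) := fun i : 'I_s => M (sigma i) in
    residue_sorted M' /\
    (cond_a M' \/ cond_b R' \/ cond_c R' \/ cond_d R' \/
     cond_e R' \/ cond_f R' \/ cond_g R' \/ cond_h M').
Proof.
have hloc' (sigma : 'S_s) i : local_ring_with (M (sigma i)) by apply: hlocal.
apply: (iff_trans (ramanujanP hs hlocal)); rewrite -/(below_threshold M).
split=> [below|[sigma [_ cond]]]; last first.
  (* The threshold is invariant under renumbering, so each condition is tested on the renumbered
     family. *)
  apply/(below_threshold_perm M sigma).
  case: cond => [|[|[|[|[|[|[|]]]]]]].
  - exact: cond_a_below.
  - exact: (cond_b_below hs).
  - exact: (cond_c_below hs).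
  - exact: (cond_d_below hs).
  - exact: (cond_e_below hs (hloc' sigma)).
  - exact: (cond_f_below hs (hloc' sigma)).
  - exact: (cond_g_below hs).
  - exact: (cond_h_below hs).
pose i0 : 'I_s := insubd (Ordinal hs) 0; pose i1 : 'I_s := insubd (Ordinal hs) (s - 1)%N.
have i00 : i0 = 0%N :> nat by rewrite val_insubd (ltnW hs).
have [sigma qs [place2 place3]] := exists_placement hlocal hsorted i1 i00.
exists sigma; split; first exact: sorted_perm.
have prodE : (\prod_(0 <= k < s) ideal_card hs (fun i => M (sigma i)) k =
    \prod_i #|M i|)%N.
  by rewrite prod_ideal_card [RHS](reindex_inj (@perm_inj _ sigma)).
apply: (@below_threshold_cond s hs _ (fun i => M (sigma i)) (hloc' sigma)).
- exact: sorted_perm.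
- exact/(below_threshold_perm M sigma).
- by rewrite prodE.
- rewrite prodE => p3 q3; apply: place3 => //.
  by rewrite -qs.
Qed.
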